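(* Let $d\ge -1$ be an integer and let $\mathcal{C}$ be an $\infty$-category. For all objects $X,Y\in\mathcal{C}$ there is a canonical isomorphism of simplicial sets $$\alpha\colon \operatorname{Hom}^{R}_{h_d\mathcal{C}}\left(\theta_d(X),\theta_d(Y)\right)\xrightarrow{\ \sim\ } h_{d-1}\operatorname{Hom}^{R}_{\mathcal{C}}(X,Y)$$ such that $\alpha\circ\beta=\gamma$, where $\beta\colon \operatorname{Hom}^{R}_{\mathcal{C}}(X,Y)\to \operatorname{Hom}^{R}_{h_d\mathcal{C}}(\theta_d(X),\theta_d(Y))$ is the map induced by $\theta_d\colon\mathcal{C}\to h_d\mathcal{C}$, and $\gamma=\theta_{d-1}\colon \operatorname{Hom}^{R}_{\mathcal{C}}(X,Y)\to h_{d-1}\operatorname{Hom}^{R}_{\mathcal{C}}(X,Y)$ is the canonical map of the $\infty$-category (Kan complex) $\operatorname{Hom}^{R}_{\mathcal{C}}(X,Y)$ to its $(d-1)$-homotopy category.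
   Context: $\infty$-categories are quasi-categories. An ordinary category is identified with its nerve. Right mapping space: $\operatorname{Hom}^{R}_{\mathcal{C}}(X,Y)$ is the simplicial set whose $n$-simplices are the maps $\Delta^{n+1}\to\mathcal{C}$ whose restriction to $\Delta^{\{0,\dots,n\}}$ is constant at $X$ and which send the vertex $n+1$ to $Y$; it is a Kan complex when $\mathcal{C}$ is an $\infty$-category. Relative homotopy: for simplicial sets $A\subseteq B$ and $D$, $B\rtimes_A D$ is the pushout of $A\leftarrow A\times D\to B\times D$ (projection and inclusion). For maps $f,g\colon B\to X$ with $f|_A=g|_A$, a homotopy relative to $A$ is an extension of the induced map $f\cup g\colon B\rtimes_A\partial\Delta^1\to X$ to $B\rtimes_A\Delta^1$. When $X$ is an $\infty$-category, being homotopic relative to $A$ is an equivalence relation. For $A\subseteq B\subseteq C$, $[A,B,C;X]$ denotes the set of maps $B\to X$ that admit an extension to $C$, modulo homotopy relative to $A$. The $d$-homotopy category $h_d\mathcal{C}$ of an $\infty$-category $\mathcal{C}$, with canonical map $\theta_d\colon\mathcal{C}\to h_d\mathcal{C}$, is defined for $d\ge -2$ as follows. Write $K^j=\mathrm{sk}^jK$ for the $j$-skeleton of a simplicial set $K$. - For $d\ge 1$: $h_d\mathcal{C}$ is the (essentially unique) simplicial set with bijections $\operatorname{Hom}(K,h_d\mathcal{C})\simeq[K^{d-1},K^d,K^{d+1};\mathcal{C}]$ natural in the simplicial set $K$; $\theta_d$ sends a map $K\to\mathcal{C}$ to the class of its restriction to $K^d$. - For $d=0$: let $\tilde h_0\mathcal{C}$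 be the preordered set of objects of $\mathcal{C}$ with $x\le y$ iff $\operatorname{Map}_{\mathcal{C}}(x,y)\ne\varnothing$; $h_0\mathcal{C}$ is the nerve of the poset obtained by identifying isomorphic objects of $\tilde h_0\mathcal{C}$, and $\theta_0$ is the obvious map. - For $d=-1$: $h_{-1}\mathcal{C}=\varnothing$ if $\mathcal{C}=\varnothing$ and $h_{-1}\mathcal{C}=\Delta^0$ otherwise, with the unique map $\theta_{-1}$. - For $d=-2$: $h_{-2}\mathcal{C}=\Delta^0$, with the unique map $\theta_{-2}$. *)

(* Defs.v *)
From Stdlib Require Import Relations.
From HB Require Import structures.
From mathcomp Require Import all_boot all_order all_algebra.
From mathcomp Require Import boolp.

Set Implicit Arguments.
Unset Strict Implicit.
Unset Printing Implicit Defensive.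

Definition quot (T : Type) (R : relation T) : Type :=
  {P : T -> Prop | exists x, P = clos_refl_sym_trans T R x}.

Definition qclass (T : Type) (R : relation T) (x : T) : quot R :=
  exist _ (clos_refl_sym_trans T R x) (ex_intro _ x erefl).

Lemma qclassP (T : Type) (R : relation T) (q : quot R) :
  exists x, q = qclass R x.
Proof. by case: q => P [x Px]; exists x; apply: eq_exist. Qed.

Lemma qclass_eqP (T : Type) (R : relation T) (x y : T) :
  qclass R x = qclass R y <-> clos_refl_sym_trans T R x y.
Proof.
split=> [[/(congr1 (fun P => P y)) ->]|xy]; first exact: rst_refl.
apply: eq_exist; apply/funext => z; apply/propext; split=> h.
- exact: rst_trans (rst_sym _ _ _ _ xy) h.
- exact: rst_trans xy h.
Qed.

Lemma qclass_rel (T : Type) (R : relation T) (x y : T) :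
  R x y -> qclass R x = qclass R y.
Proof. by move=> xy; apply/qclass_eqP; apply: rst_step. Qed.

Definition qlift (T S : Type) (R : relation T) (f : T -> S) (q : quot R) : S :=
  f (projT1 (cid (qclassP q))).

Lemma qliftE (T S : Type) (R : relation T) (f : T -> S) (x : T) :
  (forall y z, R y z -> f y = f z) -> qlift f (qclass R x) = f x.
Proof.
move=> fR; rewrite /qlift; case: cid => y /= /qclass_eqP.
by elim=> // [a b /fR ->|a b c _ -> _ ->].
Qed.

(* The object [n] of the simplex category is ['I_n.+1].                      *)
Record mono (m n : nat) := Mono {
  mono_fun :> {ffun 'I_m.+1 -> 'I_n.+1};
  monoP : [forall i : 'I_m.+1, forall j : 'I_m.+1,
             (i <= j) ==> (mono_fun i <= mono_fun j)] }.

HB.instance Definition _ m n := [isSub for @mono_fun m n].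
HB.instance Definition _ m n := [Finite of mono m n by <:].

Lemma mono_le m n (a : mono m n) (i j : 'I_m.+1) : i <= j -> a i <= a j.
Proof. by move=> ij; have /forallP/(_ i)/forallP/(_ j)/implyP := monoP a; apply. Qed.

Lemma mono_eq m n (a b : mono m n) : a =1 b -> a = b.
Proof. by move=> ab; apply/val_inj/ffunP. Qed.

Fact mkmono_subproof m n (f : 'I_m.+1 -> 'I_n.+1) :
  (forall i j : 'I_m.+1, i <= j -> f i <= f j) ->
  [forall i : 'I_m.+1, forall j : 'I_m.+1,
     (i <= j) ==> ([ffun i => f i] i <= [ffun i => f i] j)].
Proof.
by move=> fP; apply/forallP => i; apply/forallP => j; apply/implyP; rewrite !ffunE; apply: fP.
Qed.

Definition mkmono m n (f : 'I_m.+1 -> 'I_n.+1)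
    (fP : forall i j : 'I_m.+1, i <= j -> f i <= f j) : mono m n :=
  Mono (mkmono_subproof fP).

Lemma mkmonoE m n (f : 'I_m.+1 -> 'I_n.+1) fP i : @mkmono m n f fP i = f i.
Proof. by rewrite ffunE. Qed.

Definition mono_id n : mono n n := @mkmono n n (fun i => i) (fun i j ij => ij).

Fact mono_comp_subproof l m n (b : mono m n) (a : mono l m) (i j : 'I_l.+1) :
  i <= j -> b (a i) <= b (a j).
Proof. by move=> ij; do 2!apply: mono_le. Qed.

Definition mono_comp l m n (b : mono m n) (a : mono l m) : mono l n :=
  mkmono (mono_comp_subproof b a).

Lemma mono_compE l m n (b : mono m n) (a : mono l m) i :
  mono_comp b a i = b (a i).
Proof. exact: mkmonoE. Qed.

Definition mono_cst m n (k : 'I_n.+1) : mono m n :=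
  @mkmono m n (fun=> k) (fun _ _ _ => leqnn k).

(* The map [a * id] : [m+1] -> [n+1] extending [a] and sending the last      *)
(* vertex to the last vertex.                                                *)
Definition mono_join_fun m n (a : mono m n) (i : 'I_m.+2) : 'I_n.+2 :=
  if unlift ord_max i is Some j then lift ord_max (a j) else ord_max.

Fact mono_join_subproof m n (a : mono m n) (i j : 'I_m.+2) :
  i <= j -> mono_join_fun a i <= mono_join_fun a j.
Proof.
rewrite /mono_join_fun; case: unliftP => [i' ->|->]; case: unliftP => [j' ->|->].
- by rewrite !lift_max; apply: mono_le.
- by move=> _; apply: leq_ord.
- by rewrite lift_max leqNgt ltn_ord.
- by [].
Qed.

Definition mono_join m n (a : mono m n) : mono m.+1 n.+1 :=
  mkmono (mono_join_subproof a).

Lemma mono_joinE m n (a : mono m n) i : mono_join a i = mono_join_fun a i.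
Proof. exact: mkmonoE. Qed.

Lemma mono_join_id n : mono_join (mono_id n) = mono_id n.+1.
Proof.
apply: mono_eq => i; rewrite !mkmonoE /mono_join_fun.
by case: (unliftP ord_max i) => [j|] -> //; rewrite mkmonoE.
Qed.

Lemma mono_join_comp l m n (b : mono m n) (a : mono l m) :
  mono_join (mono_comp b a) = mono_comp (mono_join b) (mono_join a).
Proof.
apply: mono_eq => i; rewrite !mkmonoE /mono_join_fun.
by case: (unliftP ord_max i) => [j _|_]; rewrite ?liftK ?mkmonoE // unlift_none.
Qed.

Arguments mono_id : simpl never.
Arguments mono_comp : simpl never.
Arguments mono_cst : simpl never.
Arguments mono_join : simpl never.

Record sset := SSet {
  simp :> nat -> Type;
  sact : forall m n, mono m n -> simp n -> simp m;
  sact_id : forall n (x : simp n), sact (mono_id n) x = x;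
  sact_comp : forall l m n (b : mono m n) (a : mono l m) (x : simp n),
    sact (mono_comp b a) x = sact a (sact b x) }.

Arguments sact {s m n}.

Record smap (K L : sset) := SMap {
  smap_fun :> forall n, K n -> L n;
  smap_nat : forall m n (a : mono m n) (x : K n),
    smap_fun (sact a x) = sact a (smap_fun x) }.

Arguments smap_fun {K L} s n x.

Lemma smap_eq (K L : sset) (f g : smap K L) :
  (forall n (x : K n), f n x = g n x) -> f = g.
Proof.
case: f g => [f fP] [g gP] /= fg.
have efg : f = g by apply: functional_extensionality_dep => n; apply/funext => x.
by rewrite -{}efg in gP *; congr SMap; apply: Prop_irrelevance.
Qed.

Definition sid (K : sset) : smap K K :=
  @SMap K K (fun n x => x) (fun _ _ _ _ => erefl).

Fact scomp_subproof (K L M : sset) (g : smap L M) (f : smap K L) m n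
    (a : mono m n) (x : K n) : g m (f m (sact a x)) = sact a (g n (f n x)).
Proof. by rewrite !smap_nat. Qed.

Definition scomp (K L M : sset) (g : smap L M) (f : smap K L) : smap K M :=
  @SMap K M (fun n x => g n (f n x)) (scomp_subproof g f).

Definition is_siso (K L : sset) (f : smap K L) : Prop :=
  exists g : smap L K, scomp g f = sid K /\ scomp f g = sid L.

Definition siso (K L : sset) : Prop := exists f : smap K L, is_siso f.

Definition snonempty (K : sset) : Prop := exists n, inhabited (K n).

Definition sset_empty : sset :=
  @SSet (fun=> False) (fun _ _ _ x => x) (fun _ _ => erefl)
    (fun _ _ _ _ _ _ => erefl).

Fact Delta_id_subproof k n (x : mono n k) : mono_comp x (mono_id n) = x.
Proof. by apply: mono_eq => i; rewrite !mkmonoE. Qed.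

Fact Delta_comp_subproof k l m n (b : mono m n) (a : mono l m) (x : mono n k) :
  mono_comp x (mono_comp b a) = mono_comp (mono_comp x b) a.
Proof. by apply: mono_eq => i; rewrite !mkmonoE. Qed.

Definition Delta (k : nat) : sset :=
  @SSet (fun n => mono n k) (fun m n a x => mono_comp x a)
    (@Delta_id_subproof k) (@Delta_comp_subproof k).

Fact Delta_map_subproof k l (b : mono k l) m n (a : mono m n) (x : Delta k n) :
  mono_comp b (sact a x) = sact (s := Delta l) a (mono_comp b x).
Proof. by apply: mono_eq => i; rewrite !mkmonoE. Qed.

Definition Delta_map k l (b : mono k l) : smap (Delta k) (Delta l) :=
  @SMap (Delta k) (Delta l) (fun n x => mono_comp b x) (Delta_map_subproof b).

Lemma Delta_map_id k : Delta_map (mono_id k) = sid (Delta k).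
Proof. by apply: smap_eq => n x; apply: mono_eq => i; rewrite !mkmonoE. Qed.

Lemma Delta_map_comp k l m (c : mono l m) (b : mono k l) :
  Delta_map (mono_comp c b) = scomp (Delta_map c) (Delta_map b).
Proof. by apply: smap_eq => n x; apply: mono_eq => i; rewrite !mkmonoE. Qed.

Fact yoneda_subproof (K : sset) k (x : K k) m n (a : mono m n) (b : Delta k n) :
  sact (sact a b) x = sact a (sact b x).
Proof. exact: sact_comp. Qed.

Definition yoneda (K : sset) k (x : K k) : smap (Delta k) K :=
  @SMap (Delta k) K (fun n b => sact b x) (yoneda_subproof x).

Definition degen (K : sset) n (x : K 0) : K n := sact (mono_cst n ord0) x.

Definition vertex (K : sset) n (x : K n) (i : 'I_n.+1) : K 0 :=
  sact (mono_cst 0 i) x.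

Record ssub (K : sset) := SSub {
  ssub_mem :> forall n, K n -> Prop;
  ssub_act : forall m n (a : mono m n) (x : K n),
    ssub_mem x -> ssub_mem (sact a x) }.

Arguments ssub_mem {K} s n x.

Section SubSset.
Variables (K : sset) (A : ssub K).

Definition sub_act m n (a : mono m n) (x : {x : K n | A n x}) : {x : K m | A m x} :=
  exist _ (sact a (sval x)) (ssub_act a (svalP x)).

Fact sub_id_subproof n x : @sub_act n n (mono_id n) x = x.
Proof. by case: x => x xA; apply: eq_exist; rewrite /= sact_id. Qed.

Fact sub_comp_subproof l m n (b : mono m n) (a : mono l m) x :
  sub_act (mono_comp b a) x = sub_act a (sub_act b x).
Proof. by case: x => x xA; apply: eq_exist; rewrite /= sact_comp. Qed.

Definition sub_sset : sset := SSet sub_id_subproof sub_comp_subproof.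

Definition sub_incl : smap sub_sset K :=
  @SMap sub_sset K (fun n x => sval x) (fun _ _ _ _ => erefl).
End SubSset.

Coercion sub_sset : ssub >-> sset.

Section SubMap.
Variables (K L : sset) (A : ssub K) (B : ssub L) (f : smap K L).
Hypothesis fAB : forall n (x : K n), A n x -> B n (f n x).

Definition sub_map_fun n (x : sub_sset A n) : sub_sset B n :=
  exist _ (f n (sval x)) (fAB (svalP x)).

Fact sub_map_subproof m n (a : mono m n) (x : sub_sset A n) :
  sub_map_fun (sact a x) = sact a (sub_map_fun x).
Proof. by apply: eq_exist; rewrite /= smap_nat. Qed.

Definition sub_map : smap A B := @SMap A B sub_map_fun sub_map_subproof.
End SubMap.

Section Product.
Variables K L : sset.

Fact prod_id_subproof n (x : K n * L n) :
  (sact (mono_id n) x.1, sact (mono_id n) x.2) = x.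
Proof. by case: x => x y; rewrite !sact_id. Qed.

Fact prod_comp_subproof l m n (b : mono m n) (a : mono l m) (x : K n * L n) :
  (sact (mono_comp b a) x.1, sact (mono_comp b a) x.2) =
  (sact a (sact b x.1), sact a (sact b x.2)).
Proof. by rewrite !sact_comp. Qed.

Definition sprod : sset :=
  @SSet (fun n => (K n * L n)%type)
    (fun m n a x => (sact a x.1, sact a x.2)) prod_id_subproof prod_comp_subproof.

Definition sproj1 : smap sprod K :=
  @SMap sprod K (fun n x => x.1) (fun _ _ _ _ => erefl).
End Product.

Fact sprod_map_subproof (K K' L L' : sset) (f : smap K K') (g : smap L L') m n
    (a : mono m n) (x : sprod K L n) :
  (f m (sact a x).1, g m (sact a x).2) =
  sact (s := sprod K' L') a (f n x.1, g n x.2).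
Proof. by rewrite /= !smap_nat. Qed.

Definition sprod_map (K K' L L' : sset) (f : smap K K') (g : smap L L') :
    smap (sprod K L) (sprod K' L') :=
  @SMap (sprod K L) (sprod K' L') (fun n x => (f n x.1, g n x.2))
    (sprod_map_subproof f g).

Section Pushout.
Variables (S T1 T2 : sset) (u1 : smap S T1) (u2 : smap S T2).

Inductive pushout_rel n : T1 n + T2 n -> T1 n + T2 n -> Prop :=
  PushoutRel (s : S n) : pushout_rel (inl (u1 n s)) (inr (u2 n s)).

Definition pushout_pre m n (a : mono m n) (t : T1 n + T2 n) : T1 m + T2 m :=
  match t with inl x => inl (sact a x) | inr y => inr (sact a y) end.

Definition pushout_act m n (a : mono m n) :
    quot (@pushout_rel n) -> quot (@pushout_rel m) :=
  qlift (fun t => qclass (@pushout_rel m) (pushout_pre a t)).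

Lemma pushout_actE m n (a : mono m n) t :
  pushout_act a (qclass _ t) = qclass _ (pushout_pre a t).
Proof.
apply: qliftE => _ _ [s] /=; apply: qclass_rel.
by rewrite -!smap_nat; apply: PushoutRel.
Qed.

Fact pushout_id_subproof n q : @pushout_act n n (mono_id n) q = q.
Proof.
by have [[x|y] ->] := qclassP q; rewrite pushout_actE /= sact_id.
Qed.

Fact pushout_comp_subproof l m n (b : mono m n) (a : mono l m) q :
  pushout_act (mono_comp b a) q = pushout_act a (pushout_act b q).
Proof.
by have [[x|y] ->] := qclassP q; rewrite !pushout_actE /= sact_comp.
Qed.

Definition pushout : sset := SSet pushout_id_subproof pushout_comp_subproof.

Fact pushout_inl_subproof m n (a : mono m n) (x : T1 n) :
  qclass (@pushout_rel m) (inl (sact a x)) =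
  pushout_act a (qclass (@pushout_rel n) (inl x)).
Proof. by rewrite pushout_actE. Qed.

Definition pushout_inl : smap T1 pushout :=
  @SMap T1 pushout (fun n x => qclass (@pushout_rel n) (inl x))
    pushout_inl_subproof.

Fact pushout_inr_subproof m n (a : mono m n) (y : T2 n) :
  qclass (@pushout_rel m) (inr (sact a y)) =
  pushout_act a (qclass (@pushout_rel n) (inr y)).
Proof. by rewrite pushout_actE. Qed.

Definition pushout_inr : smap T2 pushout :=
  @SMap T2 pushout (fun n y => qclass (@pushout_rel n) (inr y))
    pushout_inr_subproof.

Lemma pushout_comm : scomp pushout_inl u1 = scomp pushout_inr u2.
Proof. by apply: smap_eq => n s; apply: qclass_rel; apply: PushoutRel. Qed.

Section Copairing.
Variables (X : sset) (f1 : smap T1 X) (f2 : smap T2 X).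
Hypothesis f12 : scomp f1 u1 = scomp f2 u2.

Definition copair_pre n (t : T1 n + T2 n) : X n :=
  match t with inl x => f1 n x | inr y => f2 n y end.

Lemma copair_preE n t :
  qlift (@copair_pre n) (qclass (@pushout_rel n) t) = copair_pre t.
Proof.
by apply: qliftE => _ _ [s] /=; have /(congr1 (fun h : smap S X => h n s)) := f12.
Qed.

Fact copair_subproof m n (a : mono m n) (q : pushout n) :
  qlift (@copair_pre m) (sact a q) = sact a (qlift (@copair_pre n) q).
Proof.
by have [[x|y] ->] := qclassP q; rewrite /= pushout_actE !copair_preE /= smap_nat.
Qed.

Definition copair : smap pushout X := @SMap pushout X (fun n => qlift (@copair_pre n)) copair_subproof.

Lemma copair_inl : scomp copair pushout_inl = f1.
Proof. by apply: smap_eq => n x; rewrite /= copair_preE. Qed.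

Lemma copair_inr : scomp copair pushout_inr = f2.
Proof. by apply: smap_eq => n x; rewrite /= copair_preE. Qed.
End Copairing.
End Pushout.

Fact boundary_subproof k m n (a : mono m n) (x : Delta k n) :
  (exists j, forall i, x i != j) -> exists j, forall i, (sact a x : mono _ _) i != j.
Proof. by case=> j xj; exists j => i; rewrite mkmonoE. Qed.

Definition boundary (k : nat) : ssub (Delta k) :=
  @SSub (Delta k) (fun n (x : mono n k) => exists j, forall i, x i != j)
    (@boundary_subproof k).

Fact horn_subproof k (l : 'I_k.+1) m n (a : mono m n) (x : Delta k n) :
  (exists2 j, j != l & forall i, x i != j) ->
  exists2 j, j != l & forall i, (sact a x : mono _ _) i != j.
Proof. by case=> j jl xj; exists j => // i; rewrite mkmonoE. Qed.

Definition horn (k : nat) (l : 'I_k.+1) : ssub (Delta k) :=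
  @SSub (Delta k)
    (fun n (x : mono n k) => exists2 j, j != l & forall i, x i != j)
    (@horn_subproof k l).

Definition infty_category (C : sset) : Prop :=
  forall (n : nat) (l : 'I_n.+1), 0 < l < n ->
  forall f : smap (horn l) C,
  exists g : smap (Delta n) C, scomp g (sub_incl (horn l)) = f.

Fact skel_subproof (K : sset) d m n (a : mono m n) (x : K n) :
  (exists k (b : mono n k) (y : K k), k <= d /\ x = sact b y) ->
  exists k (b : mono m k) (y : K k), k <= d /\ sact a x = sact b y.
Proof.
case=> k [b] [y] [kd ->]; exists k, (mono_comp b a), y.
by rewrite sact_comp.
Qed.

Definition skel (d : nat) (K : sset) : ssub K :=
  @SSub K (fun n x => exists k (b : mono n k) (y : K k), k <= d /\ x = sact b y)
    (@skel_subproof K d).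

Fact skel_incl_subproof d e (K : sset) (de : d <= e) n (x : K n) :
  skel d K n x -> skel e K n (sid K n x).
Proof.
by case=> k [b] [y] [kd ->]; exists k, b, y; split=> //; apply: leq_trans de.
Qed.

Definition skel_incl d e (K : sset) (de : d <= e) : smap (skel d K) (skel e K) :=
  sub_map (skel_incl_subproof de).

Fact skel_map_subproof d (K L : sset) (u : smap K L) n (x : K n) :
  skel d K n x -> skel d L n (u n x).
Proof.
by case=> k [b] [y] [kd ->]; exists k, b, (u k y); rewrite smap_nat.
Qed.

Definition skel_map d (K L : sset) (u : smap K L) : smap (skel d K) (skel d L) :=
  sub_map (@skel_map_subproof d K L u).

(* Inclusions A <= B <= C of simplicial sets are given by maps               *)
(* [i : smap A B] and [j : smap B C].                                        *)
Definition rtimes (A B : sset) (i : smap A B) (D : sset) : sset :=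
  pushout (sproj1 A D) (sprod_map i (sid D)).

Fact rtimes_map_subproof (A B : sset) (i : smap A B) (D E : sset) (v : smap D E) :
  scomp (pushout_inl (sproj1 A E) (sprod_map i (sid E))) (sproj1 A D) =
  scomp (scomp (pushout_inr (sproj1 A E) (sprod_map i (sid E)))
               (sprod_map (sid B) v))
        (sprod_map i (sid D)).
Proof.
apply: smap_eq => n [x y].
have := pushout_comm (sproj1 A E) (sprod_map i (sid E)).
by move/(congr1 (fun h : smap (sprod A E) _ => h n (x, v n y))).
Qed.

Definition rtimes_map (A B : sset) (i : smap A B) (D E : sset) (v : smap D E) :
    smap (rtimes i D) (rtimes i E) :=
  copair (rtimes_map_subproof i v).

Section Cup.
Variables (A B X : sset) (i : smap A B) (f g : smap B X).
Hypothesis fg : scomp f i = scomp g i.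

(* A simplex of the boundary of Delta^1 is constant, so it lies over the     *)
(* vertex that is the value at [ord0].                                       *)
Definition cup_pre n (x : sprod B (boundary 1) n) : X n :=
  if (sval x.2 : mono n 1) ord0 == ord0 then f n x.1 else g n x.1.

Fact cup_pre_subproof m n (a : mono m n) (x : sprod B (boundary 1) n) :
  cup_pre (sact a x) = sact a (cup_pre x).
Proof.
case: x => b [s sP]; rewrite /cup_pre /= mono_compE.
have -> : s (a ord0) = s ord0.
  case: sP => j sj; move: (s ord0) (s (a ord0)) (sj ord0) (sj (a ord0)) => p q.
  rewrite -!val_eqE /= => pj qj; apply/val_inj => /=.
  by move: (ltn_ord p) (ltn_ord q) (ltn_ord j) pj qj; case: (val p) => [|[|?]] //;
    case: (val q) => [|[|?]] //; case: (val j) => [|[|?]].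
by case: ifP => _; rewrite smap_nat.
Qed.

Definition cup_prod : smap (sprod B (boundary 1)) X := 
  @SMap (sprod B (boundary 1)) X cup_pre cup_pre_subproof.

Fact cup_subproof :
  scomp (scomp f i) (sproj1 A (boundary 1)) =
  scomp cup_prod (sprod_map i (sid (boundary 1))).
Proof.
apply: smap_eq => n [x y]; rewrite /= /cup_pre /=; case: ifP => // _.
exact: (congr1 (fun h : smap A X => h n x) fg).
Qed.

Definition cup : smap (rtimes i (boundary 1)) X := copair cup_subproof.
End Cup.

Definition rel_homotopic (A B X : sset) (i : smap A B) (f g : smap B X) : Prop :=
  exists fg : scomp f i = scomp g i,
  exists h : smap (rtimes i (Delta 1)) X,
    scomp h (rtimes_map i (sub_incl (boundary 1))) = cup fg.

Definition extendable (B C X : sset) (j : smap B C) (f : smap B X) : Prop :=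
  exists g : smap C X, scomp g j = f.

Definition bracket_rel (A B C X : sset) (i : smap A B) (j : smap B C) :
    relation {f : smap B X | extendable j f} :=
  fun f g => rel_homotopic i (sval f) (sval g).

(* [A, B, C; X]; on an infinity-category X relative homotopy is already an   *)
(* equivalence relation, so the closure taken by [quot] adds nothing.        *)
Definition bracket (A B C X : sset) (i : smap A B) (j : smap B C) : Type :=
  quot (@bracket_rel A B C X i j).

(* The first condition says that f is constant at X on the simplices of      *)
(* Delta^{n+1} with vertices in {0, ..., n}.                                 *)
Definition HomR_pred (C : sset) (X Y : C 0) n (f : smap (Delta n.+1) C) : Prop :=
  (forall m (s : mono m n.+1), (forall i, s i != ord_max) -> f m s = degen m X) /\
  f 0 (mono_cst 0 ord_max) = Y.

Section HomR.
Variables (C : sset) (X Y : C 0).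

Fact HomR_act_subproof m n (a : mono m n) (f : smap (Delta n.+1) C) :
  HomR_pred X Y f -> HomR_pred X Y (scomp f (Delta_map (mono_join a))).
Proof.
case=> fX fY; split=> [k s sP|] /=.
  apply: fX => i; rewrite mono_compE mono_joinE /mono_join_fun; have := sP i.
  case: unliftP => [j _ _|->]; first by rewrite eq_sym neq_lift.
  by rewrite eqxx.
rewrite -[RHS]fY; congr (f 0 _); apply: mono_eq => i.
by rewrite !mkmonoE /mono_join_fun unlift_none.
Qed.

Definition HomR_act m n (a : mono m n)
    (f : {f : smap (Delta n.+1) C | HomR_pred X Y f}) :
    {f : smap (Delta m.+1) C | HomR_pred X Y f} :=
  exist _ (scomp (sval f) (Delta_map (mono_join a)))
    (HomR_act_subproof a (svalP f)).

Fact HomR_id_subproof n f : @HomR_act n n (mono_id n) f = f.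
Proof.
case: f => f fP; apply: eq_exist => /=.
by rewrite mono_join_id Delta_map_id; apply: smap_eq.
Qed.

Fact HomR_comp_subproof l m n (b : mono m n) (a : mono l m) f :
  HomR_act (mono_comp b a) f = HomR_act a (HomR_act b f).
Proof.
case: f => f fP; apply: eq_exist => /=.
by rewrite mono_join_comp Delta_map_comp; apply: smap_eq.
Qed.

Definition HomR : sset := SSet HomR_id_subproof HomR_comp_subproof.
End HomR.

Section HomRMap.
Variables (C D : sset) (t : smap C D) (X Y : C 0).

Fact HomR_map_pred n (f : smap (Delta n.+1) C) :
  HomR_pred X Y f -> HomR_pred (t 0 X) (t 0 Y) (scomp t f).
Proof.
case=> fX fY; split=> [m s sP|] /=; last by rewrite fY.
by rewrite fX // /degen smap_nat.
Qed.

Definition HomR_map_fun n (f : HomR X Y n) : HomR (t 0 X) (t 0 Y) n :=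
  exist _ (scomp t (sval f)) (HomR_map_pred (svalP f)).

Fact HomR_map_subproof m n (a : mono m n) (f : HomR X Y n) :
  HomR_map_fun (sact a f) = sact a (HomR_map_fun f).
Proof. by apply: eq_exist; apply: smap_eq. Qed.

Definition HomR_map : smap (HomR X Y) (HomR (t 0 X) (t 0 Y)) :=
  @SMap (HomR X Y) (HomR (t 0 X) (t 0 Y)) HomR_map_fun HomR_map_subproof.
End HomRMap.

Definition hm1 (C : sset) : sset :=
  if pselect (snonempty C) then Delta 0 else sset_empty.

Section Nerve.
Variables (P : Type) (le : relation P).

Definition is_chain n (p : 'I_n.+1 -> P) : Prop :=
  forall i j : 'I_n.+1, i <= j -> le (p i) (p j).

Definition nerve_simp n := {p : 'I_n.+1 -> P | is_chain p}.

Definition nerve_act m n (a : mono m n) (p : nerve_simp n) : nerve_simp m :=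
  exist (@is_chain m) (fun i => sval p (a i)) (fun i j ij => svalP p _ _ (mono_le a ij)).

Fact nerve_id_subproof n p : @nerve_act n n (mono_id n) p = p.
Proof.
by case: p => p pP; apply: eq_exist; apply/funext => i /=; rewrite mkmonoE.
Qed.

Fact nerve_comp_subproof l m n (b : mono m n) (a : mono l m) p :
  nerve_act (mono_comp b a) p = nerve_act a (nerve_act b p).
Proof.
by case: p => p pP; apply: eq_exist; apply/funext => i /=; rewrite mono_compE.
Qed.

Definition nerve : sset := SSet nerve_id_subproof nerve_comp_subproof.
End Nerve.

(* Map(x, y) is modelled by the right mapping space. *)
Definition ob_le (C : sset) : relation (C 0) := fun x y => snonempty (HomR x y).

Definition ob_iso (C : sset) : relation (C 0) :=
  fun x y => ob_le x y /\ ob_le y x.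

Definition ob_quot (C : sset) : Type := quot (@ob_iso C).

Definition ob_quot_le (C : sset) : relation (ob_quot C) :=
  fun p q => exists x y : C 0,
    [/\ p = qclass _ x, q = qclass _ y & ob_le x y].

Definition h0 (C : sset) : sset := nerve (@ob_quot_le C).

Section Theta0.
Variable C : sset.

Fact theta0_edge n (x : C n) (i j : 'I_n.+1) :
  i <= j -> ob_le (vertex x i) (vertex x j).
Proof.
move=> ij.
have eP : forall k l : 'I_2, k <= l ->
    (if k == ord0 then i else j) <= (if l == ord0 then i else j).
  by case=> [[|[|?]]] ? // [[|[|?]]].
pose e : mono 1 n := mkmono eP.
exists 0; constructor; exists (yoneda (sact e x)); split=> [m s sP|] /=.
  rewrite /degen /vertex -!sact_comp; congr sact; apply: mono_eq => k.
  rewrite !mkmonoE; have := sP k.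
  by case: (s k) => [[|[|?]]].
by rewrite -sact_comp; congr sact; apply: mono_eq => k; rewrite !mkmonoE.
Qed.

Fact theta0_le n (x : C n) :
  is_chain (@ob_quot_le C) (fun i : 'I_n.+1 => qclass (@ob_iso C) (vertex x i)).
Proof.
by move=> i j ij; exists (vertex x i), (vertex x j); split=> //; apply: theta0_edge.
Qed.

Definition theta0_fun n (x : C n) : h0 C n :=
  exist (@is_chain _ (@ob_quot_le C) n) (fun i => qclass (@ob_iso C) (vertex x i)) (theta0_le x).

Fact theta0_subproof m n (a : mono m n) (x : C n) :
  theta0_fun (sact a x) = sact a (theta0_fun x).
Proof.
apply: eq_exist; apply/funext => i /=; congr qclass.
by rewrite /vertex -sact_comp; congr sact; apply: mono_eq => k; rewrite !mkmonoE.
Qed.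

Definition theta0 : smap C (h0 C) :=
  @SMap C (h0 C) theta0_fun theta0_subproof.
End Theta0.

(* With d = e.+1 >= 1, [skel_bracket e K C] is [K^{d-1}, K^d, K^{d+1}; C].   *)
Definition skel_ext (e : nat) (K C : sset) : Type :=
  {f : smap (skel e.+1 K) C | extendable (skel_incl K (leqnSn e.+1)) f}.

Definition skel_bracket (e : nat) (K C : sset) : Type :=
  bracket C (skel_incl K (leqnSn e)) (skel_incl K (leqnSn e.+1)).

Definition skel_class (e : nat) (K C : sset) (f : skel_ext e K C) :
    skel_bracket e K C :=
  qclass _ f.

Fact skel_pull_subproof (e : nat) (K L C : sset) (u : smap L K)
    (f : skel_ext e K C) :
  extendable (skel_incl L (leqnSn e.+1)) (scomp (sval f) (skel_map e.+1 u)).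
Proof.
case: f => f [g gf] /=; exists (scomp g (skel_map e.+2 u)).
rewrite -gf; apply: smap_eq => n x /=; congr (g n _).
exact: eq_exist.
Qed.

Definition skel_pull (e : nat) (K L C : sset) (u : smap L K)
    (f : skel_ext e K C) : skel_ext e L C :=
  exist _ (scomp (sval f) (skel_map e.+1 u)) (skel_pull_subproof u f).

Fact skel_restr_subproof (e : nat) (K C : sset) (f : smap K C) :
  extendable (skel_incl K (leqnSn e.+1)) (scomp f (sub_incl (skel e.+1 K))).
Proof. by exists (scomp f (sub_incl (skel e.+2 K))); apply: smap_eq. Qed.

Definition skel_restr (e : nat) (K C : sset) (f : smap K C) : skel_ext e K C :=
  exist _ (scomp f (sub_incl (skel e.+1 K))) (skel_restr_subproof e f).

(* [H] represents K |-> [K^{d-1}, K^d, K^{d+1}; C], and [theta] corresponds  *)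
(* to the restriction of maps K -> C to K^d. The second clause is the        *)
(* naturality of [phi] in K, written on representatives.                     *)
Definition represents (e : nat) (C H : sset) (theta : smap C H) : Prop :=
  exists phi : forall K : sset, smap K H -> skel_bracket e K C,
  [/\ forall K, bijective (phi K),
      forall (K L : sset) (u : smap L K) (x : smap K H) (f : skel_ext e K C),
        phi K x = skel_class f -> phi L (scomp x u) = skel_class (skel_pull u f)
    & forall (K : sset) (f : smap K C),
        phi K (scomp theta f) = skel_class (skel_restr e f)].

(* [H] with [theta] is the d-homotopy category of [C]. It is determined up   *)
(* to a unique isomorphism under [C], and accordingly it is specified up to  *)
(* isomorphism for d <= 0 as well. For d = -1, -2 every map into [H] is      *)
(* unique, so there is no condition on [theta].                              *)
Definition is_hcat (d : int) (C H : sset) (theta : smap C H) : Prop :=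
  match d with
  | Posz e.+1 => represents e theta
  | Posz 0 => exists2 f : smap H (h0 C), is_siso f & scomp f theta = theta0 C
  | Negz 0 => siso H (hm1 C)
  | Negz 1 => siso H (Delta 0)
  | Negz _ => False
  end.

Record hcat (d : int) (C : sset) := HCat {
  hcat_sset :> sset;
  hcat_theta : smap C hcat_sset;
  hcatP : is_hcat d hcat_theta }.

Arguments hcat_theta {d C} h.

(* Main.v *)
Require Import Defs.
From Stdlib Require Import Relations.
From mathcomp Require Import all_boot all_order all_algebra.
From mathcomp Require Import boolp zify.

(** A right mapping space is made of simplices of [C]: by [hom_simp_surj], an
[n]-simplex of [HomR X Y] is an [n.+1]-simplex of [C] whose last face is constant
at [X] and whose last vertex is [Y], and its faces are the remaining faces. The
proof recasts the [d]-homotopy category as conditions on faces of simplices, so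
that passing to mapping spaces is a shift of dimension by one.

For [d >= 1], call two [d]-simplices homotopic when they are the faces 0 and 1 of
a [d.+1]-simplex whose other faces are those of the degenerate simplex that doubles
the vertex 0 ([htpy 0]). In an infinity-category this is an equivalence
relation, and the variants that double another vertex imply it ([htpy_le0]). Cutting the prism on a [d]-simplex into
[d.+1]-simplices then shows that a homotopy relative to the boundary is a chain of
such relations ([rel_homotopic_htpy], [htpy_rel_homotopic]). A further horn filling
([replace_face]) shows that whether a boundary has a filler depends only on the
homotopy classes of its faces. Consequently the universal property of
[theta : C -> H] says the following ([represents_htrunc]): [theta] is bijective in
dimensions below [d], in dimension [d] it is the quotient by homotopy, in dimension
[d.+1] it is onto and a simplex of [H] is determined by its boundary, and above
that dimension every boundary in [H] has exactly one filler. This is [is_htrunc],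
and these conditions determine [H] up to isomorphism under [C] ([htrunc_unique]).

The homotopy is chosen at the vertex 0, far from the last vertex, hence a homotopy
of simplices of [HomR X Y] is literally a homotopy of the corresponding simplices
of [C] ([htpy_hom_simp]). All conditions for [C -> H] in degree [d.+1] therefore
yield those for [HomR X Y -> HomR (theta X) (theta Y)] in degree [d]
([htrunc_HomR]); lifting a simplex of the target needs [replace_face], to make the
last face equal to the constant simplex rather than homotopic to it. Uniqueness
gives the isomorphism. When [d = 1], the target [h0] of the mapping space satisfies
the conditions in degree 0, because edges of the mapping space can be reversed
([htrunc_theta0]).

For [d <= 0] both sides have at most one simplex in each dimension, and what
remains is to see that they are nonempty together. For [d = 0] this holds because
mapping spaces compose, so that the order on isomorphism classes of objects can be
tested on [X] and [Y] themselves. *)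

Set Implicit Arguments.
Unset Strict Implicit.
Unset Printing Implicit Defensive.

(** * Cofaces and codegeneracies *)

Lemma mono_eqn m n (a b : mono m n) : (forall i, a i = b i :> nat) -> a = b.
Proof. by move=> ab; apply: mono_eq => i; apply: val_inj; apply: ab. Qed.

Lemma mono_le_n m n (a : mono m n) i : a i <= n.
Proof. exact: leq_ord. Qed.

Fact coface_ord n (i : nat) (k : 'I_n.+1) : bump i k < n.+2.
Proof. by rewrite /bump; have := ltn_ord k; lia. Qed.

Fact coface_mono n (i : nat) (k l : 'I_n.+1) : k <= l ->
  Ordinal (coface_ord i k) <= Ordinal (coface_ord i l).
Proof. by rewrite /= /bump; lia. Qed.

Definition coface n (i : nat) : mono n n.+1 := mkmono (@coface_mono n i).

Lemma cofaceE n i k : @coface n i k = (i <= k) + k :> nat.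
Proof. by rewrite mkmonoE. Qed.

Fact codegen_ord n (i : nat) (k : 'I_n.+2) : minn n (k - (i < k)) < n.+1.
Proof. lia. Qed.

Fact codegen_mono n (i : nat) (k l : 'I_n.+2) : k <= l ->
  Ordinal (codegen_ord i k) <= Ordinal (codegen_ord i l).
Proof. by rewrite /=; lia. Qed.

(** The truncation by [minn] makes [codegen n.+1] equal to [codegen n], so that
[codegen i] is a retraction of [coface i] also for the last coface. *)
Definition codegen n (i : nat) : mono n.+1 n := mkmono (@codegen_mono n i).

Lemma codegenE n i k : @codegen n i k = minn n (k - (i < k)) :> nat.
Proof. by rewrite mkmonoE. Qed.

Definition monoE := (mono_compE, cofaceE, codegenE).

Definition misses k n (a : mono k n) (j : nat) := forall i, a i != j :> nat.

Definition nonsurj k n (a : mono k n) := exists2 j, j <= n & misses a j.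

Lemma misses_comp l k n (a : mono k n) (b : mono l k) j :
  misses a j -> misses (mono_comp a b) j.
Proof. by move=> aj i; rewrite mono_compE. Qed.

Lemma nonsurj_comp l k n (a : mono k n) (b : mono l k) :
  nonsurj a -> nonsurj (mono_comp a b).
Proof. by case=> j jn aj; exists j => //; apply: misses_comp. Qed.

Lemma mono_compA k l m n (c : mono m n) (b : mono l m) (a : mono k l) :
  mono_comp c (mono_comp b a) = mono_comp (mono_comp c b) a.
Proof. by apply: mono_eq => i; rewrite !mono_compE. Qed.

Lemma mono_comp_idl m n (a : mono m n) : mono_comp (mono_id n) a = a.
Proof. by apply: mono_eq => i; rewrite mono_compE mkmonoE. Qed.

Lemma mono_comp_idr m n (a : mono m n) : mono_comp a (mono_id m) = a.
Proof. by apply: mono_eq => i; rewrite mono_compE mkmonoE. Qed.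

Lemma factor_coface k n (a : mono k n.+1) j : j <= n.+1 -> misses a j ->
  a = mono_comp (coface n j) (mono_comp (codegen n j) a).
Proof.
move=> jn aj; apply: mono_eqn => i; rewrite !monoE.
by have := aj i; have := mono_le_n a i; lia.
Qed.

Lemma misses_coface n j : misses (coface n j) j.
Proof. by move=> i; rewrite !monoE; lia. Qed.

Lemma nonsurj_lt k n (a : mono k n) : k < n -> nonsurj a.
Proof.
move=> kn; have [j jP] : exists j, j \notin codom a.
  apply/existsP; rewrite -[[exists _, _]]negbK negb_exists; apply/negP => /forallP h.
  have : #|'I_n.+1| <= #|codom a|.
    by apply/subset_leq_card/subsetP => j _; have := h j; rewrite negbK.
  move/leq_trans/(_ (leq_image_card a _)); rewrite !card_ord ltnS.
  by rewrite leqNgt kn.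
exists j; first exact: leq_ord.
move=> i; apply: contra jP => /eqP ij; apply/codomP; exists i.
exact/val_inj/esym.
Qed.

(* Once cofaces and codegeneracies are evaluated, both an equality of composites
   and the omission of a vertex are linear arithmetic with case distinctions. *)
Ltac mono_lia := let t := fresh "t" in
  apply: mono_eqn => t; have := ltn_ord t; rewrite ?monoE ?mkmonoE; lia.
Ltac misses_lia := let t := fresh "t" in
  move=> t; have := ltn_ord t; rewrite ?monoE; lia.

Lemma codegenK n j : j <= n.+1 ->
  mono_comp (codegen n j) (coface n j) = mono_id n.
Proof. by move=> jn; mono_lia. Qed.

Lemma smap_at (K L : sset) (f g : smap K L) : f = g ->
  forall n (x : K n), f n x = g n x.
Proof. by move=> ->. Qed.

(** * Filling compatible families of faces *)

Notation face i x := (sact (coface _ i) x).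

Lemma sact2 (K : sset) l m n (b : mono m n) (a : mono l m) (x : K n) :
  sact a (sact b x) = sact (mono_comp b a) x.
Proof. by rewrite sact_comp. Qed.

Lemma face_face (K : sset) n (x : K n.+2) i j : i < j -> j <= n.+2 ->
  face i (face j x) = face j.-1 (face i x).
Proof. by move=> ij jn; rewrite !sact2; congr sact; mono_lia. Qed.

(** Families of faces are indexed by all of [nat], so that the simplicial
identities need no ordinal arithmetic. *)
Definition compatible (K : sset) m (S : pred nat) (y : nat -> K m.+1) :=
  forall i j, i < j -> j <= m.+2 -> S i -> S j ->
  face i (y j) = face j.-1 (y i).

Definition fill (K : sset) m (S : pred nat) :=
  forall y : nat -> K m.+1, compatible S y ->
  exists w : K m.+2, forall j, j <= m.+2 -> S j -> face j w = y j.

Section Glue.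
Variables (K : sset) (m : nat) (S : pred nat).

Fact faces_subproof k n (a : mono k n) (x : Delta m.+2 n) :
  (exists j, [/\ j <= m.+2, S j & misses x j]) ->
  exists j, [/\ j <= m.+2, S j & misses (sact a x : mono _ _) j].
Proof. by case=> j [jm Sj xj]; exists j; split=> //; apply: misses_comp. Qed.

Definition faces : ssub (Delta m.+2) :=
  @SSub (Delta m.+2)
    (fun n (x : mono n m.+2) => exists j, [/\ j <= m.+2, S j & misses x j])
    faces_subproof.

Variable y : nat -> K m.+1.
Hypothesis yS : compatible S y.

(** If a simplex omits two vertices it factors through both faces, and the
simplicial identity for these two faces compares the results. *)
Lemma glue_unique k (s : mono k m.+2) i j :
  i <= m.+2 -> S i -> misses s i -> j <= m.+2 -> S j -> misses s j ->
  sact (mono_comp (codegen _ i) s) (y i) = sact (mono_comp (codegen _ j) s) (y j).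
Proof.
wlog ij : i j / i < j => [hw|] im Si si jm Sj sj.
  have [ij|ji|->//] := ltngtP i j; first exact: hw.
  by apply/esym/hw.
have e : mono_comp (codegen _ j) s =
    mono_comp (coface _ i) (mono_comp (codegen _ i) (mono_comp (codegen _ j) s)).
  apply: factor_coface; first lia.
  move=> t; rewrite !monoE; have := si t; have := sj t; have := mono_le_n s t; lia.
rewrite [in RHS]e [RHS]sact_comp (yS ij) // sact2; congr sact.
apply: mono_eqn => t; rewrite !monoE; have := si t; have := sj t.
by have := mono_le_n s t; lia.
Qed.

Definition glue_fun k (x : sub_sset faces k) : K k :=
  let j := projT1 (cid (svalP x)) in
  sact (mono_comp (codegen _ j) (sval x : mono _ _)) (y j).

Lemma glue_funE k (x : sub_sset faces k) j : j <= m.+2 -> S j -> misses (sval x) j ->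
  glue_fun x = sact (mono_comp (codegen _ j) (sval x : mono _ _)) (y j).
Proof.
by move=> jm Sj xj; rewrite /glue_fun; case: cid => i /= [im Si xi]; apply: glue_unique.
Qed.

Fact glue_subproof k l (a : mono k l) (x : sub_sset faces l) :
  glue_fun (sact a x) = sact a (glue_fun x).
Proof.
have [j [jm Sj xj]] := svalP x.
rewrite (glue_funE jm Sj xj) (@glue_funE _ _ j) ?sact2 ?mono_compA //.
exact: misses_comp.
Qed.

Definition glue : smap faces K := @SMap faces K glue_fun glue_subproof.
End Glue.

Lemma fill_extend (K : sset) m (S : pred nat) :
  (forall f : smap (faces m S) K,
     exists g : smap (Delta m.+2) K, scomp g (sub_incl _) = f) ->
  fill K m S.
Proof.
move=> h y yS; have [g gP] := h (glue yS).
exists (g _ (mono_id _)) => j jm Sj; rewrite -smap_nat /=.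
have dj := @misses_coface m.+1 j.
have fj : faces m S m.+1 (coface m.+1 j) by exists j.
have := smap_at gP (exist _ (coface m.+1 j) fj : sub_sset (faces m S) _).
by rewrite /= mono_comp_idl (@glue_funE _ _ _ _ yS _ _ j) //= codegenK // sact_id.
Qed.

Lemma infcat_fill (C : sset) : infty_category C ->
  forall m l, 0 < l < m.+2 -> fill C m (fun j => j != l).
Proof.
move=> hC m l lm; apply: fill_extend => f.
have lo : l < m.+3 by lia.
have sub n (x : Delta m.+2 n) :
    horn (Ordinal lo) n x -> faces m (fun j => j != l) n (sid (Delta m.+2) n x).
  by case=> j jl xj; exists j; split=> //; first exact: leq_ord.
have sub' n (x : Delta m.+2 n) : faces m (fun j => j != l) n x -> horn (Ordinal lo) n x.
  by case=> j [jm jl xj]; exists (Ordinal (jm : j < m.+3)).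
have [g gP] := hC m.+2 (Ordinal lo) lm (scomp f (Defs.sub_map sub)).
exists g; apply: smap_eq => n [x xP].
have := smap_at gP (exist _ x (sub' _ _ xP) : sub_sset (horn _) n) => /= ->.
congr (f n _); exact: eq_exist.
Qed.

Lemma fill_infcat (C : sset) :
  (forall m l, 0 < l < m.+2 -> fill C m (fun j => j != l)) -> infty_category C.
Proof.
move=> hC [|[|m]] l lm; [lia|lia|] => f.
have fP j : j != l :> nat -> j <= m.+2 -> horn l m.+1 (coface m.+1 j).
  move=> jl jm; exists (Ordinal (jm : j < m.+3)) => // i.
  exact: misses_coface.
have l0 : (ord0 : 'I_m.+3) != l by rewrite -val_eqE /=; lia.
pose y j : C m.+1 :=
  if pselect (j != l :> nat /\ j <= m.+2) is left h
  then f m.+1 (exist _ (coface m.+1 j) (fP _ h.1 h.2))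
  else f m.+1 (exist _ (coface m.+1 0) (fP 0 l0 isT)).
have yE j (h : horn l m.+1 (coface m.+1 j)) : j != l :> nat -> j <= m.+2 ->
    y j = f m.+1 (exist _ (coface m.+1 j) h).
  move=> jl jm; rewrite /y; case: pselect => [?|[]] //.
  by congr (f _ _); apply: eq_exist.
have [|w wP] := hC m l lm y.
  move=> i j ij jm il jl; have im : i <= m.+2 by lia.
  rewrite (yE _ (fP _ il im)) // (yE _ (fP _ jl jm)) // -!smap_nat.
  by congr (f _ _); apply: eq_exist => /=; mono_lia.
exists (yoneda w); apply: smap_eq => n [x [j jl xj]] /=.
have jm : j <= m.+2 by apply: leq_ord.
rewrite [in LHS](factor_coface jm xj) sact_comp wP // (yE _ (fP _ jl jm)) // -smap_nat.
by congr (f _ _); apply: eq_exist; rewrite /= -factor_coface.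
Qed.

(** A device for filling inner horns whose faces are mostly degenerate. The
simplex [p^* x] is the model: the new faces have to agree with it on every simplex
that [p] sends into the sieve [N]. Compatibility then needs checking only between
the faces that [p] does not send into [N], and the filler agrees with [p^* x]
wherever the faces do. *)
Lemma fill_sieve (C : sset) d m (x : C d) (p : mono m.+2 d)
    (N : forall k, mono k d -> Prop) l (y : nat -> C m.+1) :
  infty_category C -> 0 < l < m.+2 ->
  (forall k n (u : mono n d) (a : mono k n), N _ u -> N _ (mono_comp u a)) ->
  (forall j, j <= m.+2 -> j != l -> forall k (a : mono k m.+1),
     N _ (mono_comp (mono_comp p (coface _ j)) a) ->
     sact a (y j) = sact (mono_comp (mono_comp p (coface _ j)) a) x) ->
  (forall i j, i < j -> j <= m.+2 -> i != l -> j != l ->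
     [\/ N _ (mono_comp p (coface _ i)), N _ (mono_comp p (coface _ j)) |
       face i (y j) = face j.-1 (y i)]) ->
  (forall k (a : mono k m.+2), N _ (mono_comp p a) ->
     exists j, [/\ j <= m.+2, j != l & misses a j]) ->
  exists w : C m.+2, (forall j, j <= m.+2 -> j != l -> face j w = y j) /\
    forall k (a : mono k m.+2), N _ (mono_comp p a) ->
      sact a w = sact (mono_comp p a) x.
Proof.
move=> hC lm Nc H1 H2 H3.
have [|w wP] := infcat_fill hC lm (y := y).
  move=> i j ij jm il jl.
  have e : mono_comp (coface m.+1 j) (coface m i) =
      mono_comp (coface m.+1 i) (coface m j.-1).
    mono_lia.
  have im : i <= m.+2 by lia.
  have E : N _ (mono_comp p (mono_comp (coface m.+1 j) (coface m i))) ->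
      face i (y j) = face j.-1 (y i).
    by move=> h; rewrite !H1 // -!mono_compA -?e.
  have [h|h|//] := H2 i j ij jm il jl; apply: E.
    by rewrite e mono_compA; apply: Nc.
  by rewrite mono_compA; apply: Nc.
exists w; split=> // k a Na; have [j [jm jl aj]] := H3 k a Na.
have e := factor_coface jm aj.
rewrite [in LHS]e sact_comp wP // H1 //; last by rewrite -mono_compA -e.
by rewrite -mono_compA -e.
Qed.

(** * Homotopies of simplices as simplices of one dimension more *)

(** The model for [w] is the degeneracy of [x] that doubles the vertex [i]: all
faces except the two opposite to the copies of [i] are those of the model. *)
Definition htpy_via (C : sset) d i (x y : C d) (w : C d.+1) :=
  [/\ face i w = x, face i.+1 w = y &
      forall j, j <= d.+1 -> j != i -> j != i.+1 ->
      face j w = sact (mono_comp (codegen d i) (coface d j)) x].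

Definition htpy (C : sset) d i (x y : C d) := exists w, htpy_via i x y w.

Lemma htpy_viaE (C : sset) d i (x y : C d) w k (a : mono k d.+1) :
  htpy_via i x y w -> i <= d -> nonsurj (mono_comp (codegen d i) a) ->
  sact a w = sact (mono_comp (codegen d i) a) x.
Proof.
case=> wx wy wb im [v vd av].
have [vi|vi] := eqVneq v i.
  have ai : misses a i by move=> t; have := av t; rewrite !monoE; lia.
  by rewrite [in LHS](factor_coface _ ai) ?sact_comp ?wx //; lia.
pose v' := (i < v) + v.
have av' : misses a v' by move=> t; have := av t; rewrite !monoE /v'; lia.
have v'd : v' <= d.+1 by rewrite /v'; lia.
rewrite [in LHS](factor_coface v'd av') sact_comp wb ?sact2 -?mono_compA -?factor_coface //;
  rewrite /v'; lia.
Qed.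

Lemma htpy_bd (C : sset) d i (x y : C d) k (a : mono k d) :
  htpy i x y -> i <= d -> nonsurj a -> sact a x = sact a y.
Proof.
case=> w wP im ad.
have e : mono_comp (codegen d i) (mono_comp (coface d i.+1) a) = a.
  apply: mono_eqn => t; rewrite !monoE; have := mono_le_n a t; lia.
have := @htpy_viaE _ _ _ _ _ _ _ (mono_comp (coface d i.+1) a) wP im.
by rewrite e sact_comp; case: wP => _ -> _ ->.
Qed.

Lemma htpy_refl (C : sset) d i (x : C d) : i <= d -> htpy i x x.
Proof.
move=> im; exists (sact (codegen d i) x); split=> [||j jd ji jSi];
  rewrite sact2 // -[RHS]sact_id; congr sact;
  mono_lia.
Qed.

Section Htpy.
Variables (C : sset) (hC : infty_category C).

(** Triple the vertex 0: the faces 0, 1 and 2 of such a simplex are homotopies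
between [p], [q] and [r], and the face 2 is the missing one of an inner horn
because the dimension of [p] is positive. *)
Lemma htpy0_eucl d (p q r : C d.+1) : htpy 0 p q -> htpy 0 p r -> htpy 0 q r.
Proof.
move=> pq [B BP]; have [A AP] := pq.
pose pi := mono_comp (codegen d.+1 0) (codegen d.+2 0).
pose y j := if j == 0 then A else if j == 1 then B
  else sact (mono_comp pi (coface d.+2 j)) p.
have e0 : mono_comp pi (coface d.+2 0) = codegen d.+1 0.
  mono_lia.
have e1 : mono_comp pi (coface d.+2 1) = codegen d.+1 0.
  mono_lia.
have e2 : mono_comp pi (coface d.+2 2) = codegen d.+1 0.
  mono_lia.
have N j : 2 < j -> j <= d.+3 -> nonsurj (mono_comp pi (coface d.+2 j)).
  move=> j2 jd; exists (j - 2); first lia.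
  misses_lia.
have [||||| w [wy wN]] := @fill_sieve C _ _ p pi (fun k => @nonsurj k _) 2 y hC.
- lia.
- by move=> *; apply: nonsurj_comp.
- move=> [|[|j]] jd jl k a; rewrite /y /= ?e0 ?e1 => aN.
  + exact: htpy_viaE AP _ aN.
  + exact: htpy_viaE BP _ aN.
  + by rewrite sact2.
- move=> [|[|i]] [|[|[|j]]] // ij jd il jl; try by [constructor 2; apply: N; lia].
  constructor 3; rewrite /y /=; case: AP => -> _ _; by case: BP => ->.
- move=> k a [v vd av]; exists (v + 2 * (0 < v)).
  split; [lia|lia|].
  by move=> t; have := av t; have := ltn_ord (a t); rewrite !monoE; lia.
exists (face 2 w); split=> [||j jd j0 j1].
- rewrite face_face // wy // /y /=; by case: AP.
- rewrite face_face // wy // /y /=; by case: BP.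
- have jN : nonsurj (mono_comp (codegen d.+1 0) (coface d.+1 j)).
    exists j.-1; first lia.
    misses_lia.
  rewrite sact2 wN mono_compA e2 //.
  exact: htpy_bd pq _ jN.
Qed.

Lemma htpy0_sym d (p q : C d.+1) : htpy 0 p q -> htpy 0 q p.
Proof. by move=> pq; apply: htpy0_eucl pq _; apply: htpy_refl. Qed.

Lemma htpy0_trans d (p q r : C d.+1) : htpy 0 p q -> htpy 0 q r -> htpy 0 p r.
Proof. by move=> /htpy0_sym; apply: htpy0_eucl. Qed.

(** Double both vertices [i] and [i.+1]: the faces [i], [i.+1] are homotopies at
[i.+1] and the faces [i.+2], [i.+3] are homotopies at [i]. With the given homotopy
in the first place and degenerate ones in the second and the fourth, the third is
what is wanted. *)
Lemma htpyS d i (p q : C d) : i < d -> htpy i.+1 p q -> htpy i p q.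
Proof.
move=> id pq; have [A AP] := pq.
pose pi := mono_comp (codegen d i) (codegen d.+1 i.+2).
pose y j := if j == i then A else if j == i.+1 then sact (codegen d i.+1) q
  else if j == i.+3 then sact (codegen d i) q
  else sact (mono_comp pi (coface d.+1 j)) p.
have e0 : mono_comp pi (coface d.+1 i) = codegen d i.+1.
  mono_lia.
have e1 : mono_comp pi (coface d.+1 i.+1) = codegen d i.+1.
  mono_lia.
have e2 : mono_comp pi (coface d.+1 i.+2) = codegen d i.
  mono_lia.
have e3 : mono_comp pi (coface d.+1 i.+3) = codegen d i.
  mono_lia.
have y0 : y i = A by rewrite /y eqxx.
have y1 : y i.+1 = sact (codegen d i.+1) q by rewrite /y; do !case: ifP => //; lia.
have y3 : y i.+3 = sact (codegen d i) q by rewrite /y; do !case: ifP => //; lia.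
have yo j : j != i -> j != i.+1 -> j != i.+3 ->
    y j = sact (mono_comp pi (coface d.+1 j)) p.
  by rewrite /y; do !case: ifP => //.
have N j : j <= d.+2 -> j != i.+2 -> j != i -> j != i.+1 -> j != i.+3 ->
    nonsurj (mono_comp pi (coface d.+1 j)).
  move=> jd j2 j0 j1 j3; exists (j - 2 * (i < j)); first lia.
  misses_lia.
have bd k (a : mono k d) : nonsurj a -> sact a p = sact a q.
  by move=> aN; apply: htpy_bd pq _ aN.
have [||||| w [wy wN]] := @fill_sieve C _ _ p pi (fun k => @nonsurj k _) i.+2 y hC.
- lia.
- by move=> *; apply: nonsurj_comp.
- move=> j jd jl k a.
  have [->|j0] := eqVneq j i; first by rewrite e0 y0 => aN; apply: htpy_viaE AP _ aN.
  have [->|j1] := eqVneq j i.+1; first by rewrite e1 y1 => aN; rewrite sact2 bd.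
  have [->|j3] := eqVneq j i.+3; first by rewrite e3 y3 => aN; rewrite sact2 bd.
  by move=> _; rewrite yo // sact2.
- move=> k j kj jd kl jl.
  have [k0|k0] := eqVneq k i; last have [k1|k1] := eqVneq k i.+1; last first.
  + have [k3|k3] := eqVneq k i.+3; last by constructor 1; apply: N => //; lia.
    constructor 2; apply: N; lia.
  + have [j3|j3] := eqVneq j i.+3; last by constructor 2; apply: N; lia.
    constructor 3; rewrite k1 j3 y1 y3 !sact2; congr sact.
    mono_lia.
  have [j1|j1] := eqVneq j i.+1; last first.
    have [j3|j3] := eqVneq j i.+3; last by constructor 2; apply: N; lia.
    constructor 3; rewrite k0 j3 y0 y3 /=; case: AP => _ -> _.
    rewrite sact2 -[RHS]sact_id; congr sact.
    mono_lia.
  constructor 3; rewrite k0 j1 y0 y1 /=; case: AP => _ _ ->; [|lia..].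
  rewrite sact2 bd //; exists i; first lia.
  misses_lia.
- move=> k a [v vd av].
  exists (v + 2 * (i < v)); split; [lia|lia|].
  by move=> t; have := av t; have := ltn_ord (a t); rewrite !monoE; lia.
exists (face i.+2 w); split=> [||j jd j0 j1].
- by rewrite face_face ?wy ?y0 //=; [case: AP|lia..].
- rewrite face_face ?wy ?y1 //=; [|lia..].
  rewrite sact2 -[RHS]sact_id; congr sact.
  mono_lia.
- have jN : nonsurj (mono_comp (codegen d i) (coface d j)).
    exists (j - (i < j)); first lia.
    misses_lia.
  by rewrite sact2 wN mono_compA e2.
Qed.

Lemma htpy_le0 d i (p q : C d) : i <= d -> htpy i p q -> htpy 0 p q.
Proof. by elim: i => // i IH id /(htpyS id); apply: IH; lia. Qed.

(** The homotopy is put next to [c] in a simplex of one dimension more, in which a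
vertex other than [j] is doubled; the opposite copy of [c] is the result. The
vertex 0 is doubled unless [j = 0]. *)
Lemma replace_face d (c : C d.+2) j (q : C d.+1) : j <= d.+2 ->
  htpy 0 (face j c) q ->
  exists c' : C d.+2, face j c' = q /\
    forall i, i <= d.+2 -> i != j -> face i c' = face i c.
Proof.
move=> jd [w wP].
(* [k] is the vertex that is doubled, [j'] the face that carries [w]. *)
pose k : nat := (j == 0); pose j' := j + (0 < j).
pose pi := codegen d.+2 k.
pose N m (u : mono m d.+2) := exists v, [/\ v <= d.+2, v != j & misses u v].
pose y i := if i == k then c else if i == j' then w
  else sact (mono_comp pi (coface d.+2 i)) c.
have ek : mono_comp pi (coface d.+2 k) = mono_id _ by apply: codegenK; lia.
have ekS : mono_comp pi (coface d.+2 k.+1) = mono_id _.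
  mono_lia.
have ej : mono_comp pi (coface d.+2 j') = mono_comp (coface d.+1 j) (codegen d.+1 0).
  mono_lia.
have yk : y k = c by rewrite /y eqxx.
have yj : y j' = w by rewrite /y; do !case: ifP => //; lia.
have yo i : i != k -> i != j' -> y i = sact (mono_comp pi (coface d.+2 i)) c.
  by rewrite /y; do !case: ifP => //.
have No i : i <= d.+3 -> i != k -> i != k.+1 -> i != j' ->
    N _ (mono_comp pi (coface d.+2 i)).
  move=> id ik ikS ij; exists (i - (k < i)); split; [lia|lia|].
  misses_lia.
have jw : face (j == 0 : nat).-1 w = face j c.
  by rewrite (_ : _.-1 = 0); [case: wP|lia].
have [||||| W [Wy WN]] := @fill_sieve C _ _ c pi N k.+1 y hC.
- lia.
- move=> m n u a [v [vd vj uv]]; exists v; split=> //; exact: misses_comp.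
- move=> i id il m a.
  have [->|ik] := eqVneq i k; first by rewrite ek yk mono_comp_idl.
  have [->|ij] := eqVneq i j'; last by rewrite yo // sact2.
  rewrite ej yj => -[v [vd vj av]].
  rewrite -mono_compA (htpy_viaE wP) ?sact2 //.
  exists (v - (j < v)); first lia.
  by move=> t; have := av t; have := ltn_ord (a t); rewrite !monoE; lia.
- move=> i i' ii id il il'.
  have [ik|ik] := eqVneq i k; last have [ij|ij] := eqVneq i j'; last first.
  + by constructor 1; apply: No => //; lia.
  + have [ik'|ik'] := eqVneq i' k; last by constructor 2; apply: No; lia.
    constructor 3; rewrite ij ik' yk yj.
    have [-> ->] : j' = 0 /\ k.-1 = 0 by lia.
    by case: wP => -> _ _; congr (face _ _); lia.
  + have [ij'|ij'] := eqVneq i' j'; last by constructor 2; apply: No; lia.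
    constructor 3; rewrite ij' ik yk yj.
    have -> : k = 0 by lia.
    by case: wP => -> _ _; congr (face _ _); lia.
- move=> m a [v [vd vj av]]; exists (v + (k < v)); split; [lia|lia|].
  by move=> t; have := av t; have := ltn_ord (a t); rewrite !monoE; lia.
exists (face k.+1 W); split=> [|i id ij].
  have <- : face 1 w = q by case: wP.
  rewrite -yj -Wy; [|lia..].
  by rewrite !sact2; congr sact; mono_lia.
rewrite sact2 WN mono_compA ekS mono_comp_idl //.
by exists i; split=> //; apply: misses_coface.
Qed.
End Htpy.

(** * The simplicial characterization of the homotopy category *)

(** The homotopy category without mapping out of skeleta: only simplices and their
faces occur, which is what makes it easy to shift dimensions. The first and the
fourth field together say that in dimension [d.+1] the simplices of [H] are the
boundaries that have a filler in [C]. *)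
Record is_htrunc d (C H : sset) (theta : smap C H) : Prop := IsHtrunc {
  htrunc_surj : forall k, k <= d.+1 -> forall z : H k, exists x, theta k x = z;
  htrunc_inj : forall k, k < d -> injective (theta k);
  htrunc_htpy : forall x y : C d, theta d x = theta d y <-> htpy 0 x y;
  htrunc_sep : forall n, d <= n -> forall z z' : H n.+1,
    (forall j, j <= n.+1 -> face j z = face j z') -> z = z';
  htrunc_fill : forall m, d <= m -> fill H m xpredT }.

Section Unique.
Variables (d : nat) (C H H' : sset) (t : smap C H) (t' : smap C H').
Hypotheses (tP : is_htrunc d t) (t'P : is_htrunc d t').

(** The graph of the comparison map: up to dimension [d] both [H] and [H'] are
covered by [C], and a simplex of either is determined by its faces of these
dimensions. *)
Definition matches n (z : H n) (z' : H' n) := forall k (a : mono k n), k <= d ->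
  exists x : C k, sact a z = t k x /\ sact a z' = t' k x.

Lemma matches_act m n (a : mono m n) (z : H n) z' :
  matches z z' -> matches (sact a z) (sact a z').
Proof. by move=> zz k b kd; rewrite !sact2; apply: zz. Qed.

Lemma matches_theta n (x : C n) : matches (t n x) (t' n x).
Proof. by move=> k a kd; exists (sact a x); rewrite !smap_nat. Qed.

Lemma matches_fun_low n (z : H n) z1 z2 : n <= d ->
  matches z z1 -> matches z z2 -> z1 = z2.
Proof.
move=> nd h1 h2; have [x1] := h1 _ (mono_id _) nd.
have [x2] := h2 _ (mono_id _) nd; rewrite !sact_id => -[-> ->] [e ->].
move: nd; rewrite leq_eqVlt => /orP[/eqP nE|nd]; last by rewrite (htrunc_inj tP nd e).
by subst n; apply/(htrunc_htpy t'P)/(htrunc_htpy tP).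
Qed.

Lemma matches_fun n (z : H n) z1 z2 : matches z z1 -> matches z z2 -> z1 = z2.
Proof.
elim: n z z1 z2 => [|n IH] z z1 z2 h1 h2; first exact: matches_fun_low h1 h2.
have [nd|nd] := leqP n.+1 d; first exact: matches_fun_low h1 h2.
apply: (htrunc_sep t'P) => [|j jn]; first by lia.
by apply: IH (face j z) _ _ _ _; apply: matches_act.
Qed.

(** Simplices of dimension at most [d.+1] come from [C]. Above, the faces have
matches by induction, these are compatible by uniqueness, and [H'] has a filler. *)
Lemma matches_total n (z : H n) : exists z', matches z z'.
Proof.
elim: n z => [|n IH] z.
  by have [//|x <-] := htrunc_surj tP _ z; exists (t' 0 x); apply: matches_theta.
have [nd|nd] := leqP n d.
  by have [//|x <-] := htrunc_surj tP _ z; exists (t' _ x); apply: matches_theta.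
case: n nd z IH => // m md z IH.
pose y j := projT1 (cid (IH (face j z))).
have yP j : matches (face j z) (y j) by rewrite /y; case: cid.
have [|z' z'P] := @htrunc_fill _ _ _ _ t'P m (ltac:(lia)) y.
  move=> i j ij jm _ _; apply: (@matches_fun _ (face i (face j z))).
    exact: matches_act.
  by rewrite face_face //; apply: matches_act.
exists z' => k a kd.
have [|j jm aj] := @nonsurj_lt _ _ a; first by lia.
by rewrite (factor_coface jm aj) !(sact_comp (coface _ _)) z'P //; apply: yP.
Qed.

End Unique.

Lemma matches_sym d C H H' (t : smap C H) (t' : smap C H') n (z : H n) z' :
  matches d t t' z z' -> matches d t' t z' z.
Proof. by move=> zz k a kd; have [x [? ?]] := zz k a kd; exists x. Qed.

Lemma htrunc_unique d (C H H' : sset) (t : smap C H) (t' : smap C H') :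
  is_htrunc d t -> is_htrunc d t' ->
  exists alpha : smap H H', is_siso alpha /\ scomp alpha t = t'.
Proof.
move=> tP t'P.
have mapP (L L' : sset) (u : smap C L) (u' : smap C L') :
    is_htrunc d u -> is_htrunc d u' ->
    exists f : smap L L', forall n (z : L n), matches d u u' z (f n z).
  move=> uP u'P.
  pose f n (z : L n) := projT1 (cid (matches_total uP u'P z)).
  have fP n z : matches d u u' z (f n z) by rewrite /f; case: cid.
  have fN m n (a : mono m n) z : f m (sact a z) = sact a (f n z).
    apply: (matches_fun uP u'P) (fP _ _) _.
    exact: matches_act.
  by exists (SMap fN).
have [f fP] := mapP _ _ t t' tP t'P; have [g gP] := mapP _ _ t' t t'P tP.
exists f; split.
  exists g; split; apply: smap_eq => n z /=.
    by apply: (matches_fun t'P tP) (gP _ _) _; apply: matches_sym.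
  by apply: (matches_fun tP t'P) (fP _ _) _; apply: matches_sym.
apply: smap_eq => n x /=; apply: (matches_fun tP t'P) (fP _ _) _.
exact: matches_theta.
Qed.

(** * Right mapping spaces *)

Lemma mono_join_lt m n (a : mono m n) (i : 'I_m.+2) (im : i < m.+1) :
  mono_join a i = a (Ordinal im) :> nat.
Proof.
rewrite mono_joinE /mono_join_fun; case: unliftP => [j|] e.
  by rewrite lift_max; congr (a _ : nat); apply: val_inj; rewrite /= e lift_max.
by exfalso; move: im; rewrite e ltnn.
Qed.

Lemma mono_join_max m n (a : mono m n) (i : 'I_m.+2) : i = m.+1 :> nat ->
  mono_join a i = n.+1 :> nat.
Proof.
move=> im; rewrite mono_joinE /mono_join_fun; case: unliftP => [j|] // e.
by exfalso; have := ltn_ord j; move: im; rewrite e lift_max => ->; rewrite ltnn.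
Qed.

Lemma mono_join_coface n i : i <= n.+1 ->
  mono_join (coface n i) = coface n.+1 i.
Proof.
move=> id; apply: mono_eqn => t; rewrite cofaceE.
have [tn|tn] := ltnP t n.+1; first by rewrite mono_join_lt cofaceE.
by rewrite mono_join_max; have := ltn_ord t; lia.
Qed.

Lemma mono_join_codegen n i : i <= n ->
  mono_join (codegen n i) = codegen n.+1 i.
Proof.
move=> id; apply: mono_eqn => t; rewrite codegenE.
have [tn|tn] := ltnP t n.+2; first by rewrite mono_join_lt codegenE /=; lia.
by rewrite mono_join_max; have := ltn_ord t; lia.
Qed.

Section HomSimp.
Variables (C : sset) (X Y : C 0).

Definition hom_simp n (f : HomR X Y n) : C n.+1 := sval f _ (mono_id _).

Lemma hom_simp_act m n (a : mono m n) (f : HomR X Y n) :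
  hom_simp (sact a f) = sact (mono_join a) (hom_simp f).
Proof.
by rewrite /hom_simp -smap_nat /= mono_comp_idl mono_comp_idr.
Qed.

Lemma hom_simp_inj n : injective (@hom_simp n).
Proof.
case=> f fP [g gP]; rewrite /hom_simp /= => fg.
apply: eq_exist; apply: smap_eq => m s.
have -> : s = sact (s := Delta _) s (mono_id n.+1) by rewrite /= mono_comp_idl.
by rewrite !smap_nat fg.
Qed.

Definition is_hom_simp n (z : C n.+1) :=
  face n.+1 z = degen n X /\ vertex z ord_max = Y.

Lemma hom_simpP n (f : HomR X Y n) : is_hom_simp (hom_simp f).
Proof.
case: f => f [fX fY]; split; rewrite /hom_simp /vertex -smap_nat /= mono_comp_idl //.
by apply: fX => i; have := misses_coface n.+1 i.
Qed.

Lemma hom_simp_surj n (z : C n.+1) : is_hom_simp z -> exists f, hom_simp f = z :> C n.+1.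
Proof.
case=> zX zY.
have zP : HomR_pred X Y (yoneda z).
  split=> //= m s sP; rewrite (@factor_coface _ _ s n.+1) //.
  rewrite sact_comp zX /degen sact2; congr sact.
  by apply: mono_eq => i; rewrite mono_compE !mkmonoE.
by exists (exist _ (yoneda z) zP); rewrite /hom_simp /= sact_id.
Qed.

Lemma vertex_face n (z : C n.+2) j : j <= n.+1 ->
  vertex (face j z) ord_max = vertex z ord_max.
Proof.
move=> jn; rewrite /vertex sact2; congr sact.
by apply: mono_eqn => i; rewrite mono_compE !mkmonoE /= /bump jn.
Qed.

Lemma degen_act m n (a : mono m n) : sact a (degen n X) = degen m X.
Proof.
by rewrite /degen sact2; congr sact; apply: mono_eq => i; rewrite mono_compE !mkmonoE.
Qed.

(** Doubling the vertex 0 commutes with adding a last vertex, and the last face of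
the simplex in [C] is degenerate on the constant last face of [hom_simp f]. *)
Lemma htpy_hom_simp d (f g : HomR X Y d) :
  htpy 0 f g <-> htpy 0 (hom_simp f) (hom_simp g).
Proof.
split=> [[w [wf wg wo]]|[w [wf wg wo]]].
  exists (hom_simp w); split=> [||j jd j0 j1].
  - by rewrite -wf hom_simp_act mono_join_coface.
  - by rewrite -wg hom_simp_act mono_join_coface.
  rewrite -mono_join_codegen //.
  have [jl|jl] := leqP j d.+1.
    by rewrite -mono_join_coface // -mono_join_comp -!hom_simp_act wo.
  have -> : j = d.+2 by lia.
  have [-> _] := hom_simpP w.
  have -> : mono_comp (mono_join (codegen d 0)) (coface d.+1 d.+2) =
     mono_comp (coface d d.+1) (codegen d 0).
    rewrite mono_join_codegen //.
    mono_lia.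
  rewrite sact_comp.
  by have [-> _] := hom_simpP f; rewrite degen_act.
have [u uw] : exists u : HomR X Y d.+1, hom_simp u = w.
  apply: hom_simp_surj; split.
    rewrite wo // (_ : mono_comp _ _ = mono_comp (coface d d.+1) (codegen d 0)).
      by rewrite sact_comp; have [-> _] := hom_simpP f; rewrite degen_act.
    mono_lia.
  by rewrite -(@vertex_face _ _ 0) // wf; have [_ ->] := hom_simpP f.
exists u; split=> [||j jd j0 j1]; apply: hom_simp_inj;
  rewrite hom_simp_act mono_join_coface // uw ?wf ?wg // wo //; last by lia.
by rewrite hom_simp_act mono_join_comp mono_join_coface // mono_join_codegen.
Qed.

(** The missing last face is prescribed to be constant at [X]. A face that exists,
[i0], is what puts the last vertex at [Y]. *)
Lemma fill_HomR m (S S' : pred nat) :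
  (forall j, j <= m.+2 -> S' j = S j) -> S' m.+3 -> (exists2 i, i <= m.+2 & S i) ->
  fill C m.+1 S' -> fill (HomR X Y) m S.
Proof.
move=> SS' Sl [i0 i0m Si0] hC y yS.
pose z j := if j == m.+3 then degen m.+2 X else hom_simp (y j).
have zE j : j <= m.+2 -> z j = hom_simp (y j).
  by rewrite /z; case: ifP => //; lia.
have zl : z m.+3 = degen m.+2 X by rewrite /z eqxx.
have [|w wP] := hC z.
  move=> i j ij jm Si Sj; rewrite (zE i); last by lia.
  have [jl|jl] := leqP j m.+2; last first.
    have -> : j = m.+3 by lia.
    by rewrite zl degen_act /=; have [-> _] := hom_simpP (y i).
  rewrite zE // -!mono_join_coface -?hom_simp_act; try lia.
  by congr hom_simp; apply: yS => //; rewrite -SS' //; lia.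
have [u uw] : exists u : HomR X Y m.+2, hom_simp u = w.
  apply: hom_simp_surj; split; first by rewrite wP.
  rewrite -(@vertex_face _ _ i0) // wP ?SS' ?zE //; last by lia.
  by have [_ ->] := hom_simpP (y i0).
exists u => j jm Sj; apply: hom_simp_inj.
by rewrite hom_simp_act mono_join_coface // uw wP ?zE ?SS' //; lia.
Qed.

(** An inner horn stays inner when a last vertex is added. *)
Lemma infcat_HomR : infty_category C -> infty_category (HomR X Y).
Proof.
move=> hC; apply: fill_infcat => m l lm.
apply: (@fill_HomR _ _ (fun j => j != l)) => //; first by lia.
  by exists 0; lia.
by apply: infcat_fill => //; lia.
Qed.
End HomSimp.

(** Every field is the corresponding field for [t], one dimension higher. Only
surjectivity in dimension [d.+1] needs more: a lift to [C] has a last face that is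
homotopic to the constant simplex, and [replace_face] makes it constant. *)
Lemma htrunc_HomR d (C H : sset) (t : smap C H) (X Y : C 0) :
  infty_category C -> is_htrunc d.+1 t -> is_htrunc d (HomR_map t X Y).
Proof.
move=> hC tP.
have tE n (f : HomR X Y n) : hom_simp (HomR_map t X Y n f) = t _ (hom_simp f) by [].
split.
- move=> k kd z.
  have [zX zY] := hom_simpP z.
  have [|c cz] := htrunc_surj tP _ (hom_simp z); first by lia.
  have [c' [c'z c'X]] : exists c', t _ c' = hom_simp z /\ face k.+1 c' = degen k X.
    move: zX; rewrite -cz -smap_nat /degen -smap_nat.
    have [kd'|kd'] := ltnP k d.+1.
      by move/(htrunc_inj tP kd'); exists c.
    have kE : k = d.+1 by lia.
    subst k => /(htrunc_htpy tP) h.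
    have [//|c' [c'X c'o]] := replace_face hC _ h.
    exists c'; split=> //; apply: (htrunc_sep tP) => // j jd; rewrite -!smap_nat.
    have [->|jl] := eqVneq j d.+2; last by rewrite c'o.
    by apply/(htrunc_htpy tP); rewrite c'X; apply: htpy0_sym.
  have [|f fc] := @hom_simp_surj C X Y _ c'.
    split=> //.
    have : t 0 (vertex c' ord_max) = t 0 Y by rewrite smap_nat c'z.
    by move/(htrunc_inj tP); apply.
  by exists f; apply: hom_simp_inj; rewrite tE fc.
- move=> k kd f g /(congr1 (@hom_simp _ _ _ _)); rewrite !tE.
  by move=> /(htrunc_inj tP _)/hom_simp_inj; apply.
- move=> f g; rewrite htpy_hom_simp -(htrunc_htpy tP) -!tE.
  by split=> [->|/hom_simp_inj].
- move=> n dn z z' zz; apply: hom_simp_inj.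
  apply: (htrunc_sep tP) => [|j jn]; first by lia.
  have [jl|jl] := leqP j n.+1.
    by rewrite -mono_join_coface // -!hom_simp_act zz.
  have -> : j = n.+2 by lia.
  by have [-> _] := hom_simpP z; have [-> _] := hom_simpP z'.
- move=> m dm; apply: (@fill_HomR _ _ _ _ _ xpredT) => //; first by exists 0.
  by apply: (htrunc_fill tP); lia.
Qed.


(** * The 0-homotopy category *)

Lemma degen0 (C : sset) (x : C 0) : degen 0 x = x.
Proof.
rewrite /degen -[RHS]sact_id; congr sact; apply: mono_eqn => i.
by have := ltn_ord i; rewrite !mkmonoE /=; lia.
Qed.

Lemma vertex1_max (C : sset) (e : C 1) : vertex e ord_max = face 0 e.
Proof. by rewrite /vertex; congr sact; apply: mono_eqn => -[[|//] i]; rewrite !mkmonoE. Qed.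

Lemma vertex1_0 (C : sset) (e : C 1) : vertex e ord0 = face 1 e.
Proof. by rewrite /vertex; congr sact; apply: mono_eqn => -[[|//] i]; rewrite !mkmonoE. Qed.

Lemma ob_leP (C : sset) (x y : C 0) : ob_le x y <-> htpy 0 y x.
Proof.
split=> [[n [f]]|[w [wy wx _]]].
  have [] := hom_simpP (sact (mono_cst 0 ord0) f).
  rewrite degen0 vertex1_max => h1 h0; exists (hom_simp (sact (mono_cst 0 ord0) f)).
  by split=> // -[|[]].
have [|f _] := @hom_simp_surj C x y 0 w; last by exists 0; constructor.
by split; rewrite ?degen0 // vertex1_max.
Qed.

Lemma ob_le_refl (C : sset) (x : C 0) : ob_le x x.
Proof. by apply/ob_leP; apply: htpy_refl. Qed.

Lemma ob_le_trans (C : sset) (x y z : C 0) : infty_category C ->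
  ob_le x y -> ob_le y z -> ob_le x z.
Proof.
move=> hC /ob_leP[e [ey ex _]] /ob_leP[e' [e'z e'y _]]; apply/ob_leP.
have [|w wP] := @infcat_fill C hC 0 1 isT (fun j => if j == 0 then e' else e).
  by case=> [|[|i]] [|[|[|j]]] //= _ _ _ _; rewrite ey e'y.
exists (face 1 w); split=> [||[|[|]] //].
  by rewrite face_face // wP //= e'z.
by rewrite -(@face_face _ _ _ 1 2) // wP //= ex.
Qed.

Lemma ob_iso_clos (C : sset) (x y : C 0) :
  (forall a b c : C 0, ob_le a b -> ob_le b c -> ob_le a c) ->
  qclass (@ob_iso C) x = qclass _ y -> ob_iso x y.
Proof.
move=> tr /qclass_eqP; elim=> //= [a|a b _ [ab ba]|a b c _ [ab ba] _ [bc cb]].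
- by split; apply: ob_le_refl.
- by split.
- by split; apply: tr; eassumption.
Qed.

Lemma h0_eq (C : sset) n (p q : h0 C n) : (forall i, sval p i = sval q i) -> p = q.
Proof. by case: p q => p pP [q qP] /= pq; apply: eq_exist; apply/funext. Qed.

(** When the preorder on objects is symmetric, as for a Kan complex, [h0] is the
discrete simplicial set on the connected components. *)
Lemma htrunc_theta0 (C : sset) :
  (forall x y : C 0, ob_le x y -> ob_le y x) ->
  (forall x y z : C 0, ob_le x y -> ob_le y z -> ob_le x z) ->
  is_htrunc 0 (theta0 C).
Proof.
move=> sy tr; split=> [k kd z|//|x y|n _ z z' zz|m _ y yS].
- case: k kd z => [|[|//]] _ z.
    have [x xP] := qclassP (sval z ord0).
    exists x; apply: h0_eq => i; rewrite ord1 xP /=; congr qclass.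
    by rewrite /vertex -/(degen 0 x) degen0.
  have [x [y [zx zy /ob_leP[e [ey ex _]]]]] := svalP z ord0 ord_max isT.
  exists e; apply: h0_eq => i /=.
  have [->|->] : i = ord0 \/ i = ord_max.
  + by case: i => -[|[|//]] ii; [left|right]; apply: val_inj.
  + by rewrite vertex1_0 ex.
  + by rewrite vertex1_max ey.
- split=> [/(congr1 (fun z => sval z ord0))/=|].
    rewrite /vertex -!/(degen 0 _) !degen0 => /(ob_iso_clos tr)[_ ?].
    exact/ob_leP.
  move/ob_leP => yx; apply: h0_eq => i; rewrite ord1 /= /vertex -!/(degen 0 _) !degen0.
  by apply: qclass_rel; split=> //; apply: sy.
- apply: h0_eq => i.
  have := zz (val i == 0) ltac:(lia).
  move=> /(congr1 (fun u => sval u (codegen n (val i == 0) i))) /=.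
  have -> // : coface n (val i == 0) (codegen n (val i == 0) i) = i.
  by apply: val_inj; have := ltn_ord i; rewrite /= !monoE; lia.
(* The vertex i is read off on the face 0, or on the face 1 if i is 0; since
   m.+2 is at least 2, any two vertices lie on a common face. *)
pose p (i : 'I_m.+3) := sval (y (val i == 0)) (codegen _ (val i == 0) i).
have pE (i : 'I_m.+3) j : j <= m.+2 -> j != i -> p i = sval (y j) (codegen _ j i).
  move=> jm ji.
  have i0 : (val i == 0 : nat) <= m.+2 by lia.
  have mi : misses (mono_cst 0 i) (val i == 0) by move=> t; rewrite mkmonoE /=; lia.
  have mj : misses (mono_cst 0 i) j by move=> t; rewrite mkmonoE /= eq_sym.
  have := @glue_unique _ _ _ y yS _ _ _ _ i0 isT mi jm isT mj.
  move/(congr1 (fun u : h0 C 0 => sval u ord0)) => /=.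
  by rewrite /p /= !ffunE.
have pP : is_chain (@ob_quot_le C) p.
  move=> i k ik; have [j jm /andP[ji jk]] : exists2 j, j <= m.+2 & (j != i) && (j != k).
    have [h0|h0] := boolP ((i == 0 :> nat) || (k == 0 :> nat)); last by exists 0; lia.
    have [h1|h1] := boolP ((i == 1 :> nat) || (k == 1 :> nat)); last by exists 1; lia.
    by exists 2; lia.
  by rewrite (pE i j) // (pE k j) //; apply: (svalP (y j)); apply: mono_le.
exists (exist _ p pP) => j jm _; apply: h0_eq => i /=.
rewrite (pE _ j) //; last by rewrite eq_sym; apply: misses_coface.
congr (sval (y j) _); apply: ord_inj; have := ltn_ord i.
by rewrite codegenE cofaceE; lia.
Qed.

(** * Relative homotopies *)

Lemma boundary1_cst n (s : mono n 1) : boundary 1 n s ->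
  s = mono_cst n ord0 \/ s = mono_cst n ord_max.
Proof.
case=> j sj; have [j0|j1] : j = ord0 \/ j = ord_max.
- by case: j {sj} => -[|[|//]] jj; [left|right]; apply: val_inj.
- right; apply: mono_eqn => i; rewrite mkmonoE /=.
  by have := sj i; rewrite j0 -val_eqE /=; have := mono_le_n s i; lia.
- left; apply: mono_eqn => i; rewrite mkmonoE /=.
  by have := sj i; rewrite j1 -val_eqE /=; have := mono_le_n s i; lia.
Qed.

Lemma cst0_boundary n : boundary 1 n (mono_cst n ord0).
Proof. by exists ord_max => i; rewrite mkmonoE. Qed.

Lemma cst1_boundary n : boundary 1 n (mono_cst n ord_max).
Proof. by exists ord0 => i; rewrite mkmonoE. Qed.

(** Relative homotopies as maps on the whole cylinder, which spares the pushout. *)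
Definition cylinder_htpy (A B X : sset) (i : smap A B) (f g : smap B X)
    (h : smap (sprod B (Delta 1)) X) :=
  [/\ forall n b, h n (b, mono_cst n ord0) = f n b,
      forall n b, h n (b, mono_cst n ord_max) = g n b &
      forall n a t, h n (i n a, t) = f n (i n a)].

Lemma rel_homotopicP (A B X : sset) (i : smap A B) (f g : smap B X) :
  rel_homotopic i f g <-> exists h, cylinder_htpy i f g h.
Proof.
split=> [[fg [h hP]]|[h [h0 h1 hi]]].
- exists (scomp h (pushout_inr (sproj1 A (Delta 1)) (sprod_map i (sid (Delta 1))))).
  have hr n (b : B n) (s : sub_sset (boundary 1) n) :
      scomp h (pushout_inr (sproj1 A (Delta 1)) (sprod_map i (sid (Delta 1)))) n
        (b, sval s) = cup_pre f g (b, s).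
    have := smap_at hP (pushout_inr (sproj1 A _) (sprod_map i (sid _)) n (b, s)).
    rewrite [RHS](smap_at (copair_inr (cup_subproof fg)) (b, s)) => E.
    rewrite -[RHS]E /=; congr (h n _).
    exact/esym/(smap_at (copair_inr (rtimes_map_subproof i _)) (b, s)).
  split=> [n b|n b|n a t].
  + by rewrite (hr n b (exist _ _ (cst0_boundary n))) /cup_pre /= mkmonoE ?eqxx.
  + by rewrite (hr n b (exist _ _ (cst1_boundary n))) /cup_pre /= mkmonoE.
  + have := smap_at (pushout_comm (sproj1 A (Delta 1)) (sprod_map i (sid (Delta 1)))) (a, t).
    rewrite /= => <-.
    have := smap_at hP (pushout_inl (sproj1 A _) (sprod_map i (sid _)) n a).
    rewrite [RHS](smap_at (copair_inl (cup_subproof fg)) a) => E.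
    rewrite -[RHS]E /=; congr (h n _).
    exact/esym/(smap_at (copair_inl (rtimes_map_subproof i _)) a).
have fg : scomp f i = scomp g i.
  by apply: smap_eq => n a; rewrite /= -(hi _ _ (mono_cst n ord_max)) h1.
have hfi : scomp (scomp f i) (sproj1 A (Delta 1)) =
    scomp h (sprod_map i (sid (Delta 1))).
  by apply: smap_eq => n [a t] /=; rewrite hi.
exists fg, (copair hfi); apply: smap_eq => n q.
have [[a|[b s]] ->] := qclassP q.
  apply: etrans (esym (smap_at (copair_inl (cup_subproof fg)) a)).
  apply: etrans (smap_at (copair_inl hfi) a); congr (copair hfi n _).
  exact: (smap_at (copair_inl (rtimes_map_subproof i _)) a).
apply: etrans (esym (smap_at (copair_inr (cup_subproof fg)) (b, s))).
transitivity (h n (b, sval s)).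
  apply: etrans (smap_at (copair_inr hfi) (b, sval s)); congr (copair hfi n _).
  exact: (smap_at (copair_inr (rtimes_map_subproof i _)) (b, s)).
case: s => s sP; rewrite /= /cup_pre /=.
by have [->|->] := boundary1_cst sP; rewrite mkmonoE /= ?eqxx ?h0 ?h1.
Qed.

Lemma rel_homotopic_pull (A B A' B' X : sset) (i : smap A B) (i' : smap A' B')
    (u0 : smap A' A) (u : smap B' B) (f g : smap B X) :
  scomp u i' = scomp i u0 -> rel_homotopic i f g ->
  rel_homotopic i' (scomp f u) (scomp g u).
Proof.
move=> uu /rel_homotopicP[h [h0 h1 hi]]; apply/rel_homotopicP.
exists (scomp h (sprod_map u (sid (Delta 1)))); split=> [n b|n b|n a t] /=.
- exact: h0.
- exact: h1.
- by have /= -> := smap_at uu a; rewrite hi.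
Qed.

Lemma skel_in d (K : sset) k (x : K k) : k <= d -> skel d K k x.
Proof. by move=> kd; exists k, (mono_id k), x; rewrite sact_id. Qed.

Section Prism.
Variables (e : nat) (K C : sset) (hC : infty_category C).
Variables (f g : smap (skel e.+1 K) C).

Fact step_mono m i (k l : 'I_m.+1) : k <= l ->
  (if i <= k then ord_max else ord0 : 'I_2) <= (if i <= l then ord_max else ord0 : 'I_2).
Proof. by move=> kl; case: ifP => // ik; rewrite ifT //; lia. Qed.

(** The [step m i] are the simplices of the interval; together with degeneracies
they index the simplices of the usual triangulation of the prism. *)
Definition step m i : mono m 1 := mkmono (@step_mono m i).

Lemma stepE m i k : step m i k = (i <= k) :> nat.
Proof. by rewrite mkmonoE; case: (i <= k). Qed.

Lemma rel_homotopic_low : rel_homotopic (skel_incl K (leqnSn e)) f g ->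
  forall k (z : sub_sset (skel e.+1 K) k), k <= e -> f k z = g k z.
Proof.
case=> fg _ k z ke.
have := smap_at fg (exist _ (sval z) (skel_in (sval z) ke) : sub_sset (skel e K) k).
by rewrite /= (_ : sub_map_fun _ _ = z) //; case: z => z zP; apply: eq_exist.
Qed.

(** The prism on a simplex of dimension [e.+1] is a chain of simplices of dimension
[e.+2], the [i]-th doubling the vertex [i]. On the boundary the homotopy is
constant, so the [i]-th simplex is a homotopy at the vertex [i]. *)
Lemma rel_homotopic_htpy : rel_homotopic (skel_incl K (leqnSn e)) f g ->
  forall z : sub_sset (skel e.+1 K) e.+1, htpy 0 (f _ z) (g _ z).
Proof.
move=> /rel_homotopicP[h [h0 h1 hi]] z.
pose P m (a : mono m e.+1) (t : mono m 1) : C m := h m (sact a z, t).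
have PN m n (a : mono m e.+1) (t : mono m 1) (b : mono n m) :
    sact b (P m a t) = P n (mono_comp a b) (mono_comp t b).
  rewrite /P -smap_nat; congr (h n _); apply: (congr1 (pair^~ _)).
  exact: sact2.
have Pb m (a : mono m e.+1) t : nonsurj a -> P m a t = f m (sact a z).
  case=> j je aj.
  have az : sval (sact a z) =
      sact (mono_comp (codegen _ j) a) (face j (sval z) : K e).
    by rewrite sact2 -factor_coface.
  have zP : skel e K m (sval (sact a z)).
    by exists e, (mono_comp (codegen _ j) a), (face j (sval z)).
  have E : sact a z = skel_incl K (leqnSn e) m (exist _ _ zP) by apply: eq_exist.
  by rewrite /P E hi.
pose x i := P e.+1 (mono_id _) (step _ i).
have x0 : x 0 = g _ z.
  rewrite /x /P sact_id -h1; congr (h _ (_, _)).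
  by apply: mono_eqn => i; rewrite stepE.
have xl : x e.+2 = f _ z.
  rewrite /x /P sact_id -h0; congr (h _ (_, _)).
  by apply: mono_eqn => i; rewrite stepE mkmonoE; have := ltn_ord i; rewrite /=; lia.
have xS i : i <= e.+1 -> htpy 0 (x i) (x i.+1).
  move=> id; apply: (htpy_le0 hC id).
  exists (P _ (codegen _ i) (step _ i.+1)); split=> [||j jd ji jS]; rewrite PN.
  - congr (P _ _ _); first by rewrite codegenK //; lia.
    by apply: mono_eqn => t; rewrite mono_compE !stepE cofaceE; lia.
  - congr (P _ _ _).
      mono_lia.
    by apply: mono_eqn => t; rewrite mono_compE !stepE cofaceE; lia.
  have jN : nonsurj (mono_comp (codegen e.+1 i) (coface e.+1 j)).
    exists (j - (i < j)); first lia.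
    misses_lia.
  by rewrite PN mono_comp_idl !Pb.
apply: (htpy0_sym hC); rewrite -x0 -xl.
have : forall i, i <= e.+2 -> htpy 0 (x 0) (x i).
  elim=> [|i IH] id; first exact: htpy_refl.
  by apply: (htpy0_trans hC) (xS i _); [apply: IH|]; lia.
exact.
Qed.
End Prism.

Lemma clos_bracket (e : nat) (K C : sset) (F G : skel_ext e K C) :
  infty_category C -> clos_refl_sym_trans _
    (@bracket_rel _ _ _ C (skel_incl K (leqnSn e)) (skel_incl K (leqnSn e.+1))) F G ->
  (forall k (z : sub_sset (skel e.+1 K) k), k <= e -> sval F k z = sval G k z) /\
  (forall z : sub_sset (skel e.+1 K) e.+1, htpy 0 (sval F _ z) (sval G _ z)).
Proof.
move=> hC; elim=> {F G} [F G FG|F|F G _ [l h]|F G J _ [l1 h1] _ [l2 h2]]; split.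
- by move=> k z ke; apply: rel_homotopic_low.
- exact: rel_homotopic_htpy.
- by [].
- by move=> z; apply: htpy_refl.
- by move=> k z ke; rewrite l.
- by move=> z; apply: htpy0_sym.
- by move=> k z ke; rewrite l1 // l2.
- by move=> z; apply: (htpy0_trans hC) (h1 z) (h2 z).
Qed.

Fact prism_ord n d (b : mono n d) (t : mono n 1) (i : 'I_n.+1) :
  ((t i == 1 :> nat) || (0 < b i)) + b i < d.+2.
Proof. by have := mono_le_n b i; lia. Qed.

Fact prism_mono n d (b : mono n d) (t : mono n 1) (i j : 'I_n.+1) : i <= j ->
  Ordinal (prism_ord b t i) <= Ordinal (prism_ord b t j).
Proof.
move=> ij /=; have := mono_le b ij; have := mono_le t ij.
by have := mono_le_n t i; have := mono_le_n t j; lia.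
Qed.

(** The map from the prism on the [d]-simplex to the [d + 1]-simplex that is the
coface 1 on the bottom and the coface 0 on the top. *)
Definition prism n d (b : mono n d) (t : mono n 1) : mono n d.+1 :=
  mkmono (@prism_mono n d b t).

Lemma prismE n d (b : mono n d) (t : mono n 1) i :
  prism b t i = ((t i == 1 :> nat) || (0 < b i)) + b i :> nat.
Proof. by rewrite mkmonoE. Qed.

(** Collapse the prism onto the simplex that carries the homotopy. *)
Lemma htpy_rel_homotopic e (C : sset) (x y : C e.+1) : htpy 0 x y ->
  rel_homotopic (skel_incl (Delta e.+1) (leqnSn e))
    (scomp (yoneda y) (sub_incl _)) (scomp (yoneda x) (sub_incl _)).
Proof.
case=> w wP; apply/rel_homotopicP.
pose h n (z : sprod (skel e.+1 (Delta e.+1)) (Delta 1) n) : C n :=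
  sact (prism (sval z.1) z.2) w.
have hN m n (a : mono m n) z : h m (sact a z) = sact a (h n z).
  rewrite /h sact2; congr sact; apply: mono_eqn => i.
  by rewrite mono_compE !prismE /= !mono_compE.
exists (SMap hN); split=> [n b|n b|n a t]; rewrite /= /h /=.
- case: wP => _ <- _; rewrite sact2; congr sact; apply: mono_eqn => i.
  by rewrite prismE monoE cofaceE mkmonoE.
- case: wP => <- _ _; rewrite sact2; congr sact; apply: mono_eqn => i.
  by rewrite prismE monoE cofaceE mkmonoE.
have N : nonsurj (sval a : mono n e.+1).
  case: a => a [k [b [c [ke /= ->]]]].
  by apply/nonsurj_comp/nonsurj_lt.
rewrite -(htpy_bd (ex_intro _ w wP)) //.
have e1 : mono_comp (codegen _ 0) (prism (sval a : mono n e.+1) t) = sval a.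
  by apply: mono_eqn => i; rewrite mono_compE codegenE prismE;
    have := mono_le_n (sval a : mono n e.+1) i; lia.
by rewrite (htpy_viaE wP) // e1.
Qed.

(** * Representing objects *)

Lemma skel_faces_sub m q n (x : Delta m.+2 n) : q < m.+2 ->
  skel q (Delta m.+2) n x -> faces m xpredT n x.
Proof.
move=> qm [k [b [y [kq ->]]]].
have [|j jm yj] := @nonsurj_lt _ _ y; first by lia.
by exists j; split=> //; apply: misses_comp.
Qed.

Lemma skel_faces_skel m q n (x : Delta m.+2 n) (qm : q < m.+2)
    (xP : skel q (Delta m.+2) n x) :
  skel q (faces m xpredT) n (exist _ x (skel_faces_sub qm xP)).
Proof.
have [k [b [y [kq xE]]]] := xP.
have yP : faces m xpredT k y by apply: (skel_faces_sub qm); apply: skel_in.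
by exists k, b, (exist _ y yP); split=> //; apply: eq_exist.
Qed.

Section SkelFaces.
Variables (m q : nat) (qm : q < m.+2).

Definition skel_faces_fun n (x : sub_sset (skel q (Delta m.+2)) n) :
  sub_sset (skel q (faces m xpredT)) n := exist _ _ (skel_faces_skel qm (svalP x)).

Fact skel_faces_subproof k n (a : mono k n) x :
  skel_faces_fun (sact a x) = sact a (skel_faces_fun x).
Proof. by apply: eq_exist; apply: eq_exist. Qed.

(** Below its dimension, a simplex and its boundary have the same skeleta. *)
Definition skel_faces : smap (skel q (Delta m.+2)) (skel q (faces m xpredT)) :=
  @SMap (skel q _) (skel q _) skel_faces_fun skel_faces_subproof.

End SkelFaces.

Lemma skel_faces_incl m q (qm : q < m.+2) (qSm : q.+1 < m.+2) :
  scomp (skel_faces qSm) (skel_incl _ (leqnSn q)) =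
  scomp (skel_incl _ (leqnSn q)) (skel_faces qm).
Proof. by apply: smap_eq => n x; apply: eq_exist; apply: eq_exist. Qed.

Section Fillable.
Variables (e : nat) (C : sset).

Definition skel_coface j : sub_sset (skel e.+1 (Delta e.+2)) e.+1 :=
  exist _ (coface e.+1 j) (skel_in (coface e.+1 j : Delta e.+2 e.+1) (leqnn _)).

Lemma extendableP (f : smap (skel e.+1 (Delta e.+2)) C) :
  extendable (skel_incl _ (leqnSn e.+1)) f <->
  exists c : C e.+2, forall j, j <= e.+2 -> face j c = f _ (skel_coface j).
Proof.
split=> [[g gf]|[c cP]].
  have idP := skel_in (mono_id e.+2 : Delta e.+2 e.+2) (leqnn _).
  exists (g _ (exist _ _ idP)) => j _; rewrite -smap_nat -gf /=.
  by congr (g _ _); apply: eq_exist; rewrite /= mono_comp_idl.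
exists (scomp (yoneda c) (sub_incl _)); apply: smap_eq => n [s sP] /=.
have [j [je _ sj]] := skel_faces_sub (ltnSn _) sP.
rewrite [in LHS](factor_coface je sj) sact_comp cP // -smap_nat; congr (f n _).
by apply: eq_exist; rewrite /= -factor_coface.
Qed.

(** The faces of a filler are replaced one after the other. *)
Lemma extendable_htpy (f g : smap (skel e.+1 (Delta e.+2)) C) : infty_category C ->
  (forall j, j <= e.+2 -> htpy 0 (f _ (skel_coface j)) (g _ (skel_coface j))) ->
  extendable (skel_incl _ (leqnSn e.+1)) f -> extendable (skel_incl _ (leqnSn e.+1)) g.
Proof.
move=> hC fg /extendableP[c cP]; apply/extendableP.
have step t : t <= e.+3 -> exists c' : C e.+2, forall j, j <= e.+2 ->
    face j c' = if j < t then g _ (skel_coface j) else f _ (skel_coface j).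
  elim: t => [|t IH] te; first by exists c.
  have [c' c'P] := IH (ltnW te).
  have [//||c2 [c2t c2o]] := @replace_face C hC e c' t (g _ (skel_coface t)).
    by rewrite c'P // ltnn; apply: fg.
  exists c2 => j je; have [->|jt] := eqVneq j t; first by rewrite ltnSn.
  rewrite c2o // c'P //; congr (if _ then _ else _); lia.
by have [c' c'P] := step _ (leqnn _); exists c' => j je; rewrite c'P // ltnS je.
Qed.
End Fillable.

Section Represents.
Variables (e : nat) (C H : sset) (theta : smap C H).
Hypotheses (hC : infty_category C) (thetaP : represents e theta).

Lemma skel_class_fill k (F : skel_ext e (Delta k) C) : k <= e.+2 ->
  exists c : C k, skel_class F = skel_class (skel_restr e (yoneda c)).
Proof.
case: F => f [g gf] ke.
exists (g _ (exist _ _ (skel_in (mono_id k : Delta k k) ke))).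
congr skel_class; apply: eq_exist; apply: smap_eq => n [b bP].
rewrite /= -smap_nat -gf /=; congr (g n _).
by apply: eq_exist; rewrite /= mono_comp_idl.
Qed.

Lemma yoneda_inj (K : sset) k (x y : K k) : yoneda x = yoneda y -> x = y.
Proof. by move=> /smap_at/(_ _ (mono_id k)); rewrite /= !sact_id. Qed.

Lemma scomp_yoneda (K L : sset) (f : smap K L) k (x : K k) :
  scomp f (yoneda x) = yoneda (f k x).
Proof. by apply: smap_eq => n a; rewrite /= smap_nat. Qed.

(** In dimension [e.+2] this is the invariance of fillability under homotopy; in
higher dimensions a simplex and its boundary have the same [e.+2]-skeleton, so that
both sides are always extendable. *)
Lemma extendable_faces m (em : e.+1 < m.+2) (F G : skel_ext e (faces m xpredT) C) :
  (forall z : sub_sset (skel e.+1 (faces m xpredT)) e.+1,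
     htpy 0 (sval F _ z) (sval G _ z)) ->
  extendable (skel_incl _ (leqnSn e.+1)) (scomp (sval F) (skel_faces em)) ->
  extendable (skel_incl _ (leqnSn e.+1)) (scomp (sval G) (skel_faces em)).
Proof.
move=> FG; have [em'|me] := ltnP e m; last first.
  (* Here the boundary is its own skeleton, and fillability is at stake. *)
  have me' : m = e by lia.
  by subst m; apply: (extendable_htpy hC) => j _; apply: FG.
move=> _; case: G {FG} => f [g gf].
exists (scomp g (skel_faces (em' : e.+2 < m.+2))); rewrite /= -gf.
apply: smap_eq => n x; have /= -> := smap_at (skel_faces_incl em em') x.
by [].
Qed.

(** A chain of homotopies on the boundary is one on the simplex, provided that all
its members are extendable there. *)
Lemma clos_bracket_faces m (em : e.+1 < m.+2) (F G : skel_ext e (faces m xpredT) C)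
    (F' G' : skel_ext e (Delta m.+2) C) :
  skel_class F = skel_class G ->
  sval F' = scomp (sval F) (skel_faces em) ->
  sval G' = scomp (sval G) (skel_faces em) -> skel_class F' = skel_class G'.
Proof.
move=> /qclass_eqP FG; elim: FG F' G' => {F G}
    [F G FG|F|F G FG IH|F G J FG IH1 GJ IH2] F' G' F'E G'E.
- apply: qclass_rel; rewrite /bracket_rel F'E G'E.
  exact: (rel_homotopic_pull (skel_faces_incl (ltnW em) em)) FG.
- by congr skel_class; case: F' F'E => [f ?]; case: G' G'E => [g ?] /= gE fE;
    apply: eq_exist; rewrite fE gE.
- by apply/esym; apply: IH.
- have G'' : extendable (skel_incl _ (leqnSn e.+1)) (scomp (sval G) (skel_faces em)).
    apply: (@extendable_faces _ _ F); first by have [] := clos_bracket hC FG.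
    by rewrite -F'E; apply: svalP.
  by rewrite (IH1 F' (exist _ _ G'')) // (IH2 _ G').
Qed.

(** The universal property is evaluated on simplices and on their boundaries. *)
Lemma represents_htrunc : is_htrunc e.+1 theta.
Proof.
case: thetaP => phi [bij phiN phiT].
have inj K : injective (phi K) := bij_inj (bij K).
have phi_theta k (x : C k) :
    phi (Delta k) (yoneda (theta k x)) = skel_class (skel_restr e (yoneda x)).
  by rewrite -scomp_yoneda phiT.
have thetaE k (x y : C k) : theta k x = theta k y <->
    skel_class (skel_restr e (yoneda x)) = skel_class (skel_restr e (yoneda y)).
  rewrite -!phi_theta; split=> [-> //|/inj]; exact: yoneda_inj.
have idP k : k <= e.+1 -> skel e.+1 (Delta k) k (mono_id k) by apply: skel_in.
split.
- move=> k ke z; have [F FE] := qclassP (phi (Delta k) (yoneda z)).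
  have [c cE] := skel_class_fill F ke; exists c.
  by apply: yoneda_inj; apply: inj; rewrite phi_theta -cE FE.
- move=> k ke x y /thetaE /qclass_eqP /(clos_bracket hC)[h _].
  have := h k (exist _ _ (idP k (ltnW ke))) ke.
  by rewrite /= !sact_id.
- move=> x y; split=> [/thetaE /qclass_eqP /(clos_bracket hC)[_ h]|xy].
    by have := h (exist _ _ (idP _ (leqnn _))); rewrite /= !sact_id.
  by apply/thetaE/esym/qclass_rel; apply: htpy_rel_homotopic.
- move=> [//|m] em z z' zz.
  have [F FE] := qclassP (phi (Delta _) (yoneda z)).
  have [F' F'E] := qclassP (phi (Delta _) (yoneda z')).
  apply: yoneda_inj; apply: inj; rewrite FE F'E.
  pose i := sub_incl (faces m xpredT).
  apply: (@clos_bracket_faces m em (skel_pull i F) (skel_pull i F')).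
  + rewrite -(phiN _ _ i _ F FE) -(phiN _ _ i _ F' F'E); congr (phi _ _).
    apply: smap_eq => n [s [j [jm _ sj]]] /=.
    by rewrite (factor_coface jm sj) !(sact_comp (coface _ _)) zz.
  + by apply: smap_eq => n [x xP]; apply: (congr1 (sval F n)); apply: eq_exist.
  + by apply: smap_eq => n [x xP]; apply: (congr1 (sval F' n)); apply: eq_exist.
- move=> m em; apply: fill_extend => u.
  have [[f [g gf]] FE] := qclassP (phi _ u).
  have em1 : e.+1 < m.+2 by lia.
  have em2 : e.+2 < m.+2 by lia.
  have fE : extendable (skel_incl _ (leqnSn e.+1)) (scomp f (skel_faces em1)).
    exists (scomp g (skel_faces em2)); rewrite -gf.
    by apply: smap_eq => n x; have /= -> := smap_at (skel_faces_incl em1 em2) x.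
  have [psi _ psiK] := bij (Delta m.+2).
  pose G : skel_ext e (Delta m.+2) C := exist _ _ fE.
  exists (psi (skel_class G)); apply: inj.
  rewrite (phiN _ _ _ _ G (psiK _)) FE; congr skel_class; apply: eq_exist.
  apply: smap_eq => n [[x xf] xP]; apply: (congr1 (f n)).
  by apply: eq_exist; apply: eq_exist.
Qed.
End Represents.

(** * Mapping spaces of homotopy categories *)

Lemma siso_inj (K L : sset) (f : smap K L) : is_siso f -> forall n, injective (f n).
Proof.
case=> g [gf _] n x y xy.
by have := smap_at gf x; rewrite /= xy; have /= -> := smap_at gf y.
Qed.

Definition subsingleton (K : sset) := forall n (x y : K n), x = y.

Lemma subsingleton_siso (K L : sset) (f : smap K L) :
  is_siso f -> subsingleton L -> subsingleton K.
Proof. by move=> fP Ls n x y; apply: (siso_inj fP). Qed.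

Lemma siso_subsingleton (K L : sset) : subsingleton K -> subsingleton L ->
  (forall n, inhabited (K n) <-> inhabited (L n)) ->
  exists f : smap K L, is_siso f.
Proof.
move=> Ks Ls KL.
have mapP (M N : sset) : subsingleton N ->
    (forall n, inhabited (M n) -> inhabited (N n)) -> exists f : smap M N, True.
  move=> Ns MN.
  have h n (x : M n) : exists y : N n, True.
    by have [y] := MN n (inhabits x); exists y.
  by exists (@SMap M N (fun n x => projT1 (cid (h n x))) (fun _ _ _ _ => Ns _ _ _)).
have [f _] := mapP K L Ls (fun n => (KL n).1).
have [g _] := mapP L K Ks (fun n => (KL n).2).
by exists f, g; split; apply: smap_eq => n x; [apply: Ks|apply: Ls].
Qed.

Lemma Delta0_subsingleton : subsingleton (Delta 0).
Proof.
move=> n x y; apply: mono_eqn => i.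
by have := mono_le_n x i; have := mono_le_n y i; lia.
Qed.

Lemma hm1_subsingleton C : subsingleton (hm1 C).
Proof.
rewrite /hm1; case: pselect => ? /=; first exact: Delta0_subsingleton.
by move=> n x; exact: False_ind x.
Qed.

Lemma hm1_inhabited C n : inhabited (hm1 C n) <-> snonempty C.
Proof.
rewrite /hm1; case: pselect => CP /=; last by split=> [[]|/CP].
by split=> // _; exact: inhabits (mono_cst n ord0).
Qed.

Section Degree.
Variables (C : sset) (hC : infty_category C) (X Y : C 0).

Lemma HomR_positive e (H H' : sset) (t : smap C H) (t' : smap (HomR X Y) H') :
  represents e t -> is_hcat e t' ->
  exists alpha : smap (HomR (t 0 X) (t 0 Y)) H',
    is_siso alpha /\ scomp alpha (HomR_map t X Y) = t'.
Proof.
move=> /(represents_htrunc hC) /(htrunc_HomR X Y hC) bP.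
case: e bP => [|e] bP t'P; last first.
  exact/(htrunc_unique bP)/(represents_htrunc (infcat_HomR hC) t'P).
have sy (f g : HomR X Y 0) : htpy 0 f g -> htpy 0 g f.
  by move=> /htpy_hom_simp fg; apply/htpy_hom_simp/htpy0_sym.
have t0P : is_htrunc 0 (theta0 (HomR X Y)).
  apply: htrunc_theta0 => [f g /ob_leP/sy/ob_leP//|f g h].
  exact/ob_le_trans/infcat_HomR.
have [u [v [vu uv]] ut] := t'P.
have [a [[b [ba ab]] at0]] := htrunc_unique bP t0P.
exists (scomp v a); split.
  exists (scomp b u); split; apply: smap_eq => n x /=.
    by have /= -> := smap_at uv (a n x); have /= -> := smap_at ba x.
  by have /= -> := smap_at ab (u n x); have /= -> := smap_at vu x.
apply: smap_eq => n x /=; have /= -> := smap_at at0 x.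
by have /= <- := smap_at ut x; have /= -> := smap_at vu (t' n x).
Qed.

(** A simplex of the nerve of a relation is determined by its vertices, and those of
a simplex of the mapping space are prescribed. *)
Lemma HomR_subsingleton_h0 (H : sset) (u : smap H (h0 C)) (x y : H 0) :
  is_siso u -> subsingleton (HomR x y).
Proof.
move=> uP n f g; apply/hom_simp_inj/(siso_inj uP)/h0_eq => i.
have [fx fy] := hom_simpP f; have [gx gy] := hom_simpP g.
have [->|il] := eqVneq i ord_max.
  have := etrans fy (esym gy) => /(congr1 (u 0)).
  rewrite /vertex !smap_nat => /(congr1 (fun z : h0 C 0 => sval z ord0)) /=.
  by rewrite !mkmonoE.
have := etrans fx (esym gx) => /(congr1 (u n)); rewrite !smap_nat.
move/(congr1 (fun z : h0 C n => sval z (codegen n n.+1 i))) => /=.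
have -> // : coface n n.+1 (codegen n n.+1 i) = i.
apply: ord_inj; rewrite cofaceE codegenE.
by move: il; rewrite -val_eqE /=; have := ltn_ord i; lia.
Qed.

Lemma HomR_zero (H H' : sset) (t : smap C H) (t' : smap (HomR X Y) H') :
  is_hcat (Posz 0) t -> is_hcat (Negz 0) t' ->
  exists alpha : smap (HomR (t 0 X) (t 0 Y)) H',
    is_siso alpha /\ scomp alpha (HomR_map t X Y) = t'.
Proof.
move=> [u uP ut] [v vP].
have H's : subsingleton H' by apply: subsingleton_siso vP _; apply: hm1_subsingleton.
have [|a aP] :=
  @siso_subsingleton (HomR (t 0 X) (t 0 Y)) _ (HomR_subsingleton_h0 uP) H's.
  move=> n; transitivity (snonempty (HomR X Y)); last first.
    rewrite -(hm1_inhabited _ n); have [w _] := vP.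
    by split=> [[z]|[z]]; constructor; [exact: w n z|exact: v n z].
  split=> [[f]|[k [f]]]; last first.
    by constructor; apply: (sact (mono_cst n ord0)); exact: HomR_map t X Y k f.
  have [fx fy] := hom_simpP (sact (mono_cst 0 ord0) f).
  set z := hom_simp _ in fx fy.
  have uX (x : C 0) : sval (u 0 (t 0 x)) ord0 = qclass _ x.
    have /= -> := smap_at ut x; congr qclass.
    by rewrite /vertex -/(degen 0 x) degen0.
  have := svalP (u 1 z) ord0 ord_max isT.
  have -> : sval (u 1 z) ord_max = qclass _ Y.
    rewrite -uX -fy /vertex smap_nat /=; congr (sval (u 1 z) _).
    by rewrite mkmonoE.
  have -> : sval (u 1 z) ord0 = qclass _ X.
    rewrite -uX -[in RHS](degen0 (t 0 X)) -fx smap_nat /=; congr (sval (u 1 z) _).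
    by apply: ord_inj; rewrite cofaceE.
  (* The order on classes only provides representatives of those of X and Y. *)
  have tr := @ob_le_trans C _ _ _ hC.
  case=> x [y [/(ob_iso_clos tr)[Xx _] /(ob_iso_clos tr)[_ yY] xy]].
  exact: tr Xx (tr _ _ _ xy yY).
exists a; split=> //; apply: smap_eq => n x; exact: H's.
Qed.

Lemma HomR_minus1 (H H' : sset) (t : smap C H) (t' : smap (HomR X Y) H') :
  is_hcat (Negz 0) t -> is_hcat (Negz 1) t' ->
  exists alpha : smap (HomR (t 0 X) (t 0 Y)) H',
    is_siso alpha /\ scomp alpha (HomR_map t X Y) = t'.
Proof.
move=> [u uP] [v vP].
have H's : subsingleton H' by apply: subsingleton_siso vP _; apply: Delta0_subsingleton.
have Hs : subsingleton H by apply: subsingleton_siso uP _; apply: hm1_subsingleton.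
have [n f g||n|a aP] := @siso_subsingleton (HomR (t 0 X) (t 0 Y)) H'.
- by apply: hom_simp_inj; apply: Hs.
- exact: H's.
- split=> _.
    by have [w _] := vP; constructor; exact: w n (mono_cst n ord0).
  have [|f _] := @hom_simp_surj H (t 0 X) (t 0 Y) n (degen _ (t 0 X)).
    by split; apply: Hs.
  by constructor.
- by exists a; split=> //; apply: smap_eq => n x; apply: H's.
Qed.
End Degree.

Local Open Scope ring_scope.

Theorem proposition2p13 (d : int) (hd : (-1 : int) <= d)
    (C : sset) (hC : infty_category C) (X Y : C 0%N)
    (hdC : hcat d C) (hdHom : hcat (d - 1) (HomR X Y)) :
  let beta := HomR_map (hcat_theta hdC) X Y in
  let gamma := hcat_theta hdHom in
  exists alpha : smap (HomR (hcat_theta hdC 0%N X) (hcat_theta hdC 0%N Y)) hdHom,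
    is_siso alpha /\ scomp alpha beta = gamma.
Proof.
move=> beta gamma; rewrite {}/beta {}/gamma.
case: hdC hdHom => H t tP [H' t'] /=.
case: d hd tP => [[|e]|[|n]] // _ tP.
- exact: HomR_zero.
- rewrite (_ : e.+1%:Z - 1 = e%:Z); last by lia.
  exact: HomR_positive.
- exact: HomR_minus1.
Qed.
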